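(* Let $\alpha>0$, $\vec\beta=(\beta_1,\beta_2)$, $\kappa$, $\phi$, $u$ be smooth in $\overline\Omega$, where $u$ solves $-\nabla\cdot(\alpha\nabla u)+\vec\beta\cdot\nabla u+\kappa u=\phi$ in $\Omega$, $u=g$ on $\partial\Omega$, and let $\partial\Omega$ be a smooth boundary curve parametrized by $(x,y)=(p(t),q(t))$. Let $(x_i,y_j)$ be an irregular stencil center point of the grid of mesh size $h$, let $(x_i^o,y_j^o)\in\partial\Omega$ be its orthogonal projection onto $\partial\Omega$, and suppose $(x_i^o,y_j^o)=(p(t_k^o),q(t_k^o))$ with $$|q'(t_k^o)/p'(t_k^o)|\le 1,\qquad q'(t_k^o)\neq\pm p'(t_k^o),\qquad q'(t_k^o)\neq\pm\tfrac{\sqrt3}{3}\,p'(t_k^o).$$ Let $S$, $w,v,\mu_r,\tau_\ell$, the $6\times4$ matrices $A_{r,\ell}$ and the constants $\xi_k,\eta_k,\omega_k$ be as defined in the context. Let real numbers $c_{r,\ell,\sigma}$ ($(r,\ell)\in S$, $\sigma=0,1,2,3$) be any solution of $$\sum_{(r,\ell)\in S}A_{r,\ell}\begin{bmatrix}c_{r,\ell,0}\\c_{r,\ell,1}\\c_{r,\ell,2}\\c_{r,\ell,3}\end{bmatrix}=0,\qquad c_{0,0,0}\neq0,\qquad \sum_{(r,\ell)\in S}c_{r,\ell,0}=1,$$ put $C_{r,\ell}=\sum_{\sigma=0}^3c_{r,\ell,\sigma}h^\sigma$, and define \begin{align*} F_{i,j}=\sum_{(r,\ell)\in S}\Big\{&g\,c_{r,\ell,0}+\big[c_{r,\ell,0}\,g^{(1)}\mu_r\omega_8+c_{r,\ell,1}\,g\big]h\\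 &+\big[g\,c_{r,\ell,2}+g^{(1)}\omega_8\mu_rc_{r,\ell,1}+\big((\eta_4f+g\omega_4+g^{(1)}\omega_{10}+g^{(2)}\omega_{15})\mu_r^2+\tau_\ell^2(\eta_1f+g\omega_1+g^{(1)}\omega_6+g^{(2)}\omega_{12})\big)c_{r,\ell,0}\big]h^2\\ &+\big[\big((\eta_5f+\eta_7f^{(0,1)}+\eta_9f^{(1,0)}+g\omega_5+g^{(1)}\omega_{11}+g^{(2)}\omega_{16}+g^{(3)}\omega_{18})\mu_r^3\\ &\quad+\tau_\ell^2(\eta_3f+\eta_6f^{(0,1)}+\eta_8f^{(1,0)}+g\omega_3+g^{(1)}\omega_9+g^{(2)}\omega_{14}+g^{(3)}\omega_{17})\mu_r\\ &\quad+\tau_\ell^3(g\omega_2+g^{(1)}\omega_7+g^{(2)}\omega_{13}+f\eta_2+f^{(0,1)}/6)\big)c_{r,\ell,0}\\ &\quad+c_{r,\ell,1}(\eta_4f+g\omega_4+g^{(1)}\omega_{10}+g^{(2)}\omega_{15})\mu_r^2+g^{(1)}\omega_8\mu_rc_{r,\ell,2}\\ &\quad+c_{r,\ell,1}(\eta_1f+g\omega_1+g^{(1)}\omega_6+g^{(2)}\omega_{12})\tau_\ell^2+g\,c_{r,\ell,3}\big]h^3\Big\}. \end{align*} Then the compact finite difference scheme $$\mathcal L_h(u_h)_{i,j}:=\sum_{(r,\ell)\in S}C_{r,\ell}\,(u_h)_{i+r,j+\ell}=F_{i,j}$$ achieves fourth-order consistency for the Dirichlet boundary condition $u=g$ at the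 point $(x_i^o,y_j^o)\in\partial\Omega$; that is, $F_{i,j}|_{h=0}=g$ and the exact solution satisfies $$\sum_{(r,\ell)\in S}C_{r,\ell}\,u(x_{i+r},y_{j+\ell})-F_{i,j}=\mathcal O(h^4).$$
   Context: **Setting.** $\Omega\subset\mathbb R^2$ is a domain with smooth boundary curve $\partial\Omega$, with $(0,0)\in\Omega$. Standing regularity: partial derivatives of $u$ up to order 4 and of $\alpha,\vec\beta,\kappa,\phi$ up to order 2 are uniformly continuous on $\overline\Omega$; derivatives of $g$ and of the parametrization $(p(t),q(t))$ of $\partial\Omega$ up to order 3 are uniformly continuous. The boundary condition reads $u(p(t),q(t))=g(t)$. At the parameter considered, $[p'(t_k^o)]^2+[q'(t_k^o)]^2\ne0$. **Reduced equation.** With $$a=\frac{\alpha_x-\beta_1}{\alpha},\quad b=\frac{\alpha_y-\beta_2}{\alpha},\quad d=-\frac{\kappa}{\alpha},\quad f=-\frac{\phi}{\alpha},$$ the equation becomes $\Delta u+au_x+bu_y+du=f$. **Grid.** $(x_i,y_j)=(ih,jh)$, $i,j\in\mathbb Z$, $h=1/N$, $N\in\mathbb N$, restricted to $\overline\Omega$. A grid point $(x_i,y_j)\in\overline\Omega$ is a regular stencil center if all nine points $(x_{i+\mu},y_{j+\nu})$, $-1\le\mu,\nu\le1$, lie in $\overline\Omega$; otherwise it is an irregular stencil center. $(u_h)_{i,j}$ denotes the value at $(x_i,y_j)$ of the numerical solution. Define $$S=\{(r,\ell): (x_i+rh,\,y_j+\ell h)\in\overline\Omega,\ r,\ell\in\{-1,0,1\}\},$$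 $$w=(x_i-x_i^o)/h,\quad v=(y_j-y_j^o)/h,\quad \mu_r=r+w,\quad \tau_\ell=\ell+v .$$ **Evaluation convention.** $a,b,d,f$ and $a^{(m,n)}=\partial_x^m\partial_y^na$ (likewise $b^{(m,n)},d^{(m,n)},f^{(m,n)}$) are evaluated at $(x_i^o,y_j^o)$. $g$ and $p^{(m)},q^{(m)},g^{(m)}$ (the $m$-th derivatives in $t$) are evaluated at $t=t_k^o$. In the formulas below write $p_m=p^{(m)}$, $q_m=q^{(m)}$ for $m=1,2,3$; powers such as $p_1^3$ are ordinary powers. **Meaning of $\mathcal O(h^4)$.** As $h\to0$, with the coefficients $c_{r,\ell,\sigma}$ bounded independently of $h$. **Constants.** Put $D_2=p_1^2-q_1^2$, $D_3=p_1^2-3q_1^2$, $D_4=p_1^4-4p_1^2q_1^2+3q_1^4$. $s_1=-q_1/p_1$, $s_2=\{(bq_1^2-q_2)p_1-aq_1^3+p_2q_1\}/(p_1D_2)$, $s_3=-2p_1q_1/D_2$, $s_4=\{a^{(0,1)}q_1^6-3(a^2-a^{(1,0)}+b^{(0,1)}/3-2d/3)p_1q_1^5+(p_1^2(4ab-a^{(0,1)}-3b^{(1,0)})-bp_2)q_1^4+(p_1^3(b^{(0,1)}-b^2-3a^{(1,0)}-2d)+(6ap_2+bq_2)p_1-p_3)q_1^3+(3b^{(1,0)}p_1^4-3(2aq_2+bp_2)p_1^2+p_1q_3+3p_2q_2)q_1^2+3p_1(bp_1^2q_2+p_1p_3/3-p_2^2-q_2^2)q_1-p_1^3q_3+3p_1^2p_2q_2\}/(p_1^2D_4)$,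 $s_5=\{3bp_1^3q_1^2-5ap_1^2q_1^3-aq_1^5-bp_1q_1^4-3p_1^3q_2+3p_1^2p_2q_1-3p_1q_1^2q_2+3p_2q_1^3\}/(p_1D_4)$, $s_6=\{q_1^3-3p_1^2q_1\}/(p_1D_3)$. $z_1=-1/p_1$, $z_2=-dq_1^2/D_2$, $z_3=q_1^2/D_2$, $z_4=(-aq_1^2+p_2)/(p_1D_2)$, $z_5=-1/D_2$, $z_6=-q_1\{3adp_1q_1^3-bdp_1^2q_1^2+d^{(0,1)}p_1^2q_1^2-d^{(0,1)}q_1^4+3d^{(1,0)}p_1^3q_1-3d^{(1,0)}p_1q_1^3+3dp_1^2q_2-3dp_1p_2q_1\}/(p_1D_4)$, $z_7=3q_1\{aq_1^3-bp_1q_1^2/3+p_1q_2-p_2q_1\}/D_4$, $z_8=q_1^3/(p_1D_3)$, $z_9=\{a^{(0,1)}q_1^5-3p_1(a^2-a^{(1,0)}-d)q_1^4+((ab-a^{(0,1)})p_1^2-bp_2)q_1^3+(-3(a^{(1,0)}+d)p_1^3+6ap_1p_2-p_3)q_1^2-3q_2(ap_1^2-p_2)q_1+p_1^2p_3-3p_1p_2^2\}/(p_1^2D_4)$, $z_{10}=3q_1^2/D_3$, $z_{11}=\{bq_1^3-3ap_1q_1^2+3p_1p_2-3q_1q_2\}/(p_1D_4)$, $z_{12}=-1/(p_1D_3)$. $\xi_1=-(as_1+b+s_2)/2$, $\xi_2=(b^2+(as_1+s_2)b-s_1a^{(0,1)}-b^{(0,1)}-d)/6$, $\xi_3=s_1$,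 $\xi_4=(s_1(-d-a^{(1,0)})-s_2a-s_4-b^{(1,0)})/2$, $\xi_5=s_2/2$, $\xi_6=s_4/6$, $\xi_7=-s_3/2$, $\xi_8=(s_3b-a)/6$, $\xi_9=-(s_3a+b+s_5)/2$, $\xi_{10}=s_3/2$, $\xi_{11}=s_5/6$, $\xi_{12}=-s_6/2$, $\xi_{13}=s_6/6$. $\eta_1=(z_3+1)/2$, $\eta_2=-(z_3+1)b/6$, $\eta_3=(z_3a+z_7)/2$, $\eta_4=-z_3/2$, $\eta_5=-z_7/6$, $\eta_6=z_8/2$, $\eta_7=-z_8/6$, $\eta_8=(z_{10}+1)/2$, $\eta_9=-z_{10}/6$. $\omega_1=(z_2-d)/2$, $\omega_2=([-z_2+d]b-d^{(0,1)})/6$, $\omega_3=(z_2a-d^{(1,0)}+z_6)/2$, $\omega_4=-z_2/2$, $\omega_5=-z_6/6$, $\omega_6=(az_1+z_4)/2$, $\omega_7=(a^{(0,1)}z_1-[az_1+z_4]b)/6$, $\omega_8=-z_1$, $\omega_9=([a^{(1,0)}+d]z_1+z_4a+z_9)/2$, $\omega_{10}=-z_4/2$, $\omega_{11}=-z_9/6$, $\omega_{12}=z_5/2$, $\omega_{13}=-z_5b/6$, $\omega_{14}=(z_5a+z_{11})/2$, $\omega_{15}=-z_5/2$, $\omega_{16}=-z_{11}/6$, $\omega_{17}=z_{12}/2$, $\omega_{18}=-z_{12}/6$. **Matrix.** $$A_{r,\ell}=\begin{bmatrix} \mu_r\xi_3+\tau_\ell&0&0&0\\ \mu_r^2\xi_{10}+\tau_\ell^2\xi_7+\mu_r\tau_\ell&0&0&0\\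 \mu_r\xi_{12}\tau_\ell^2-\tau_\ell^3/6+\mu_r^2\tau_\ell/2+\mu_r^3\xi_{13}&0&0&0\\ \mu_r^2\xi_5+\tau_\ell^2\xi_1&\mu_r\xi_3+\tau_\ell&0&0\\ \mu_r^3\xi_{11}+\mu_r\tau_\ell^2\xi_9+\tau_\ell^3\xi_8&\mu_r^2\xi_{10}+\tau_\ell^2\xi_7+\mu_r\tau_\ell&0&0\\ \mu_r^3\xi_6+\mu_r\tau_\ell^2\xi_4+\tau_\ell^3\xi_2&\mu_r^2\xi_5+\tau_\ell^2\xi_1&\mu_r\xi_3+\tau_\ell&0 \end{bmatrix}.$$ *)

(* Defs.v *)
From Stdlib Require Import Reals ZArith ClassicalEpsilon.
From Coquelicot Require Import Coquelicot.
Open Scope R_scope.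

(** ** Planar domains *)

Definition closure (Om : R * R -> Prop) (P : R * R) : Prop :=
  forall eps : posreal, exists Q, Om Q /\ ball P eps Q.

Definition boundary (Om : R * R -> Prop) (P : R * R) : Prop :=
  closure Om P /\ closure (fun Q => ~ Om Q) P.

Definition connected (Om : R * R -> Prop) : Prop :=
  forall U V : R * R -> Prop, open U -> open V ->
    (forall P, Om P -> U P \/ V P) ->
    (forall P, Om P -> ~ (U P /\ V P)) ->
    (forall P, Om P -> ~ U P) \/ (forall P, Om P -> ~ V P).

Definition planar_domain (Om : R * R -> Prop) : Prop :=
  (exists P, Om P) /\ open Om /\ connected Om.

(** The boundary is of class C^k: after relabelling and reorienting the axes,
    [Om] is locally the region above the graph of a C^k function. *)
Definition Ck_boundary (k : nat) (Om : R * R -> Prop) : Prop :=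
  forall P, boundary Om P ->
  exists gam : R -> R,
    (forall m s, (m <= k)%nat ->
       ex_derive_n gam m s /\ continuous (Derive_n gam m) s) /\
    (locally P (fun Q => Om Q <-> gam (fst Q) < snd Q) \/
     locally P (fun Q => Om Q <-> snd Q < gam (fst Q)) \/
     locally P (fun Q => Om Q <-> gam (snd Q) < fst Q) \/
     locally P (fun Q => Om Q <-> fst Q < gam (snd Q))).

(** ** Regularity up to the boundary *)

(** [partial_derive m n f] only makes sense inside the open set [Om]; [pd]
    extends it to the closure by continuity, as the limit from inside [Om].
    ([lim] has a junk value when that limit does not exist.) *)
Definition pd (Om : R * R -> Prop) (m n : nat) (f : R -> R -> R) (x y : R) : R :=
  lim (filtermap (fun P : R * R => partial_derive m n f (fst P) (snd P))
         (within Om (locally (x, y)))).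

Definition unif_cont_on (D : R * R -> Prop) (F : R * R -> R) : Prop :=
  forall eps : posreal, exists delta : posreal,
    forall P Q, D P -> D Q -> ball P delta Q -> ball (F P) eps (F Q).

(** The partial derivatives of [f] up to order [k] exist in [Om] and are
    uniformly continuous on the closure.  The last clause ties the boundary
    values of [f] itself to its values in [Om]. *)
Definition Ck_closure (Om : R * R -> Prop) (k : nat) (f : R -> R -> R) : Prop :=
  (forall x y, Om (x, y) -> ex_diff_n f k x y) /\
  (forall m n, (m + n <= k)%nat ->
     unif_cont_on (closure Om) (fun P => pd Om m n f (fst P) (snd P))) /\
  (forall x y, closure Om (x, y) -> pd Om 0 0 f x y = f x y).

Definition Ck_param (T : R -> Prop) (k : nat) (f : R -> R) : Prop :=
  forall m, (m <= k)%nat ->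
    (forall t, T t -> ex_derive_n f m t) /\
    uniform_continuity (Derive_n f m) T.

(** ** The elliptic equation and its reduced coefficients *)

Definition elliptic_eq (Om : R * R -> Prop)
    (alpha beta1 beta2 kappa phi u : R -> R -> R) : Prop :=
  forall x y, Om (x, y) ->
    - (partial_derive 1 0 (fun x y => alpha x y * partial_derive 1 0 u x y) x y
       + partial_derive 0 1 (fun x y => alpha x y * partial_derive 0 1 u x y) x y)
    + (beta1 x y * partial_derive 1 0 u x y + beta2 x y * partial_derive 0 1 u x y)
    + kappa x y * u x y
    = phi x y.

Definition red_a Om (alpha beta1 : R -> R -> R) (x y : R) : R :=
  (pd Om 1 0 alpha x y - beta1 x y) / alpha x y.
Definition red_b Om (alpha beta2 : R -> R -> R) (x y : R) : R :=
  (pd Om 0 1 alpha x y - beta2 x y) / alpha x y.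
Definition red_d (alpha kappa : R -> R -> R) (x y : R) : R :=
  - (kappa x y / alpha x y).
Definition red_f (alpha phi : R -> R -> R) (x y : R) : R :=
  - (phi x y / alpha x y).

(** ** Data at the boundary point: [amn] is a^{(m,n)} at the point [(p t, q t)],
    and [pm], [qm], [gm] are the m-th derivatives in [t]. *)

Class bdata := {
  p1 : R; p2 : R; p3 : R; q1 : R; q2 : R; q3 : R;
  g0 : R; g1 : R; g2 : R; g3 : R;
  a00 : R; a10 : R; a01 : R;
  b00 : R; b10 : R; b01 : R;
  d00 : R; d10 : R; d01 : R;
  f00 : R; f10 : R; f01 : R
}.

Definition bdata_at (Om : R * R -> Prop)
    (alpha beta1 beta2 kappa phi : R -> R -> R) (p q g : R -> R) (t : R) : bdata :=
  let x := p t in let y := q t in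
  let a := red_a Om alpha beta1 in
  let b := red_b Om alpha beta2 in
  let d := red_d alpha kappa in
  let f := red_f alpha phi in
  {| p1 := Derive_n p 1 t; p2 := Derive_n p 2 t; p3 := Derive_n p 3 t;
     q1 := Derive_n q 1 t; q2 := Derive_n q 2 t; q3 := Derive_n q 3 t;
     g0 := g t; g1 := Derive_n g 1 t; g2 := Derive_n g 2 t; g3 := Derive_n g 3 t;
     a00 := a x y; a10 := pd Om 1 0 a x y; a01 := pd Om 0 1 a x y;
     b00 := b x y; b10 := pd Om 1 0 b x y; b01 := pd Om 0 1 b x y;
     d00 := d x y; d10 := pd Om 1 0 d x y; d01 := pd Om 0 1 d x y;
     f00 := f x y; f10 := pd Om 1 0 f x y; f01 := pd Om 0 1 f x y |}.

Definition D2 {J : bdata} : R := p1^2 - q1^2.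
Definition D3 {J : bdata} : R := p1^2 - 3*q1^2.
Definition D4 {J : bdata} : R := p1^4 - 4*p1^2*q1^2 + 3*q1^4.

Definition s1 {J : bdata} : R := - q1/p1.
Definition s2 {J : bdata} : R :=
  ((b00*q1^2 - q2)*p1 - a00*q1^3 + p2*q1) / (p1*D2).
Definition s3 {J : bdata} : R := - 2*p1*q1/D2.
Definition s4 {J : bdata} : R :=
  (a01*q1^6
   - 3*(a00^2 - a10 + b01/3 - 2*d00/3)*p1*q1^5
   + (p1^2*(4*a00*b00 - a01 - 3*b10) - b00*p2)*q1^4
   + (p1^3*(b01 - b00^2 - 3*a10 - 2*d00) + (6*a00*p2 + b00*q2)*p1 - p3)*q1^3
   + (3*b10*p1^4 - 3*(2*a00*q2 + b00*p2)*p1^2 + p1*q3 + 3*p2*q2)*q1^2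
   + 3*p1*(b00*p1^2*q2 + p1*p3/3 - p2^2 - q2^2)*q1
   - p1^3*q3 + 3*p1^2*p2*q2) / (p1^2*D4).
Definition s5 {J : bdata} : R :=
  (3*b00*p1^3*q1^2 - 5*a00*p1^2*q1^3 - a00*q1^5 - b00*p1*q1^4
   - 3*p1^3*q2 + 3*p1^2*p2*q1 - 3*p1*q1^2*q2 + 3*p2*q1^3) / (p1*D4).
Definition s6 {J : bdata} : R := (q1^3 - 3*p1^2*q1) / (p1*D3).

Definition z1 {J : bdata} : R := - 1/p1.
Definition z2 {J : bdata} : R := - d00*q1^2/D2.
Definition z3 {J : bdata} : R := q1^2/D2.
Definition z4 {J : bdata} : R := (- a00*q1^2 + p2) / (p1*D2).
Definition z5 {J : bdata} : R := - 1/D2.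
Definition z6 {J : bdata} : R :=
  - q1*(3*a00*d00*p1*q1^3 - b00*d00*p1^2*q1^2 + d01*p1^2*q1^2 - d01*q1^4
        + 3*d10*p1^3*q1 - 3*d10*p1*q1^3 + 3*d00*p1^2*q2 - 3*d00*p1*p2*q1)
  / (p1*D4).
Definition z7 {J : bdata} : R :=
  3*q1*(a00*q1^3 - b00*p1*q1^2/3 + p1*q2 - p2*q1) / D4.
Definition z8 {J : bdata} : R := q1^3/(p1*D3).
Definition z9 {J : bdata} : R :=
  (a01*q1^5
   - 3*p1*(a00^2 - a10 - d00)*q1^4
   + ((a00*b00 - a01)*p1^2 - b00*p2)*q1^3
   + (- 3*(a10 + d00)*p1^3 + 6*a00*p1*p2 - p3)*q1^2
   - 3*q2*(a00*p1^2 - p2)*q1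
   + p1^2*p3 - 3*p1*p2^2) / (p1^2*D4).
Definition z10 {J : bdata} : R := 3*q1^2/D3.
Definition z11 {J : bdata} : R :=
  (b00*q1^3 - 3*a00*p1*q1^2 + 3*p1*p2 - 3*q1*q2) / (p1*D4).
Definition z12 {J : bdata} : R := - 1/(p1*D3).

Definition xi1 {J : bdata} : R := - (a00*s1 + b00 + s2)/2.
Definition xi2 {J : bdata} : R :=
  (b00^2 + (a00*s1 + s2)*b00 - s1*a01 - b01 - d00)/6.
Definition xi3 {J : bdata} : R := s1.
Definition xi4 {J : bdata} : R := (s1*(- d00 - a10) - s2*a00 - s4 - b10)/2.
Definition xi5 {J : bdata} : R := s2/2.
Definition xi6 {J : bdata} : R := s4/6.
Definition xi7 {J : bdata} : R := - s3/2.
Definition xi8 {J : bdata} : R := (s3*b00 - a00)/6.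
Definition xi9 {J : bdata} : R := - (s3*a00 + b00 + s5)/2.
Definition xi10 {J : bdata} : R := s3/2.
Definition xi11 {J : bdata} : R := s5/6.
Definition xi12 {J : bdata} : R := - s6/2.
Definition xi13 {J : bdata} : R := s6/6.

Definition eta1 {J : bdata} : R := (z3 + 1)/2.
Definition eta2 {J : bdata} : R := - (z3 + 1)*b00/6.
Definition eta3 {J : bdata} : R := (z3*a00 + z7)/2.
Definition eta4 {J : bdata} : R := - z3/2.
Definition eta5 {J : bdata} : R := - z7/6.
Definition eta6 {J : bdata} : R := z8/2.
Definition eta7 {J : bdata} : R := - z8/6.
Definition eta8 {J : bdata} : R := (z10 + 1)/2.
Definition eta9 {J : bdata} : R := - z10/6.

Definition omega1 {J : bdata} : R := (z2 - d00)/2.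
Definition omega2 {J : bdata} : R := ((- z2 + d00)*b00 - d01)/6.
Definition omega3 {J : bdata} : R := (z2*a00 - d10 + z6)/2.
Definition omega4 {J : bdata} : R := - z2/2.
Definition omega5 {J : bdata} : R := - z6/6.
Definition omega6 {J : bdata} : R := (a00*z1 + z4)/2.
Definition omega7 {J : bdata} : R := (a01*z1 - (a00*z1 + z4)*b00)/6.
Definition omega8 {J : bdata} : R := - z1.
Definition omega9 {J : bdata} : R := ((a10 + d00)*z1 + z4*a00 + z9)/2.
Definition omega10 {J : bdata} : R := - z4/2.
Definition omega11 {J : bdata} : R := - z9/6.
Definition omega12 {J : bdata} : R := z5/2.
Definition omega13 {J : bdata} : R := - z5*b00/6.
Definition omega14 {J : bdata} : R := (z5*a00 + z11)/2.
Definition omega15 {J : bdata} : R := - z5/2.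
Definition omega16 {J : bdata} : R := - z11/6.
Definition omega17 {J : bdata} : R := z12/2.
Definition omega18 {J : bdata} : R := - z12/6.

Definition A_mat {J : bdata} (mu tau : R) : @matrix R 6 4 :=
  [ [ mu*xi3 + tau, 0, 0, 0 ],
    [ mu^2*xi10 + tau^2*xi7 + mu*tau, 0, 0, 0 ],
    [ mu*xi12*tau^2 - tau^3/6 + mu^2*tau/2 + mu^3*xi13, 0, 0, 0 ],
    [ mu^2*xi5 + tau^2*xi1, mu*xi3 + tau, 0, 0 ],
    [ mu^3*xi11 + mu*tau^2*xi9 + tau^3*xi8,
      mu^2*xi10 + tau^2*xi7 + mu*tau, 0, 0 ],
    [ mu^3*xi6 + mu*tau^2*xi4 + tau^3*xi2,
      mu^2*xi5 + tau^2*xi1, mu*xi3 + tau, 0 ] ].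

(** ** Grid and stencil *)

Definition step (N : nat) : R := / INR N.

Definition grid (N : nat) (i j : Z) : R * R := (IZR i * step N, IZR j * step N).

Definition irregular_center (Om : R * R -> Prop) (N : nat) (i j : Z) : Prop :=
  closure Om (grid N i j) /\
  ~ (forall r l : Z, (-1 <= r <= 1)%Z -> (-1 <= l <= 1)%Z ->
       closure Om (grid N (i + r) (j + l))).

(** Nearest boundary point.  Where the boundary is smooth, the segment joining
    a point to its nearest boundary point is normal to the boundary. *)
Definition orth_projection (Om : R * R -> Prop) (P B : R * R) : Prop :=
  boundary Om B /\
  forall Q, boundary Om Q ->
    dist_euc (fst P) (snd P) (fst B) (snd B)
    <= dist_euc (fst P) (snd P) (fst Q) (snd Q).

Definition sum3 (F : Z -> R) : R := F (-1)%Z + F 0%Z + F 1%Z.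

(** Sum over the set S of those (r,l) in {-1,0,1}^2 whose grid point lies in
    the closure of [Om]. *)
Definition sumS (Om : R * R -> Prop) (N : nat) (i j : Z) (F : Z -> Z -> R) : R :=
  sum3 (fun r => sum3 (fun l =>
    if excluded_middle_informative (closure Om (grid N (i + r) (j + l)))
    then F r l else 0)).

(** mu_r and tau_l, for the boundary point [B] attached to the center (i,j). *)
Definition mu_at (N : nat) (i j : Z) (B : R * R) (r : Z) : R :=
  IZR r + (fst (grid N i j) - fst B) / step N.
Definition tau_at (N : nat) (i j : Z) (B : R * R) (l : Z) : R :=
  IZR l + (snd (grid N i j) - snd B) / step N.

Definition boundary_stencil (Om : R * R -> Prop) (T : R -> Prop) (p q : R -> R)
    (N : nat) (i j : Z) (t : R) : Prop :=
  (1 <= N)%nat /\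
  irregular_center Om N i j /\
  T t /\
  orth_projection Om (grid N i j) (p t, q t) /\
  Derive_n p 1 t <> 0 /\
  Rabs (Derive_n q 1 t / Derive_n p 1 t) <= 1 /\
  Derive_n q 1 t <> Derive_n p 1 t /\
  Derive_n q 1 t <> - Derive_n p 1 t /\
  Derive_n q 1 t <> sqrt 3 / 3 * Derive_n p 1 t /\
  Derive_n q 1 t <> - (sqrt 3 / 3 * Derive_n p 1 t).

(** ** The scheme.  The coefficients [c r l sigma] only matter for (r,l) in S
    and sigma <= 3. *)

Definition coeff_solution (J : bdata) (Om : R * R -> Prop) (N : nat) (i j : Z)
    (B : R * R) (c : Z -> Z -> nat -> R) : Prop :=
  (forall k : nat, (k < 6)%nat ->
     sumS Om N i j (fun r l =>
       coeff_mat 0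
         (Mmult (A_mat (mu_at N i j B r) (tau_at N i j B l))
                (mk_matrix 4 1 (fun sigma _ => c r l sigma))) k 0)
     = 0) /\
  c 0%Z 0%Z 0%nat <> 0 /\
  sumS Om N i j (fun r l => c r l 0%nat) = 1.

Definition coeff_bounded (Om : R * R -> Prop) (N : nat) (i j : Z) (M : R)
    (c : Z -> Z -> nat -> R) : Prop :=
  forall r l : Z, (-1 <= r <= 1)%Z -> (-1 <= l <= 1)%Z ->
    closure Om (grid N (i + r) (j + l)) ->
    forall sigma : nat, (sigma <= 3)%nat -> Rabs (c r l sigma) <= M.

Definition scheme_op (Om : R * R -> Prop) (N : nat) (c : Z -> Z -> nat -> R)
    (v : Z -> Z -> R) (i j : Z) : R :=
  sumS Om N i j (fun r l =>
    sum_f_R0 (fun sigma => c r l sigma * step N ^ sigma) 3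
    * v (i + r)%Z (j + l)%Z).

(** F_{i,j} as a polynomial in the mesh size [h]: the stencil, mu_r, tau_l and
    the coefficients [c] are kept fixed, so that F_{i,j} at h = 0 is meaningful.
    The scheme uses [h := step N]. *)
Definition scheme_rhs (J : bdata) (Om : R * R -> Prop) (N : nat) (i j : Z)
    (B : R * R) (c : Z -> Z -> nat -> R) (h : R) : R :=
  sumS Om N i j (fun r l =>
    let mu := mu_at N i j B r in
    let tau := tau_at N i j B l in
    let c0 := c r l 0%nat in
    let c1 := c r l 1%nat in
    let c2 := c r l 2%nat in
    let c3 := c r l 3%nat in
    g0*c0
    + (c0*g1*mu*omega8 + c1*g0)*h
    + (g0*c2 + g1*omega8*mu*c1
       + ((eta4*f00 + g0*omega4 + g1*omega10 + g2*omega15)*mu^2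
          + tau^2*(eta1*f00 + g0*omega1 + g1*omega6 + g2*omega12))*c0)*h^2
    + (((eta5*f00 + eta7*f01 + eta9*f10
         + g0*omega5 + g1*omega11 + g2*omega16 + g3*omega18)*mu^3
        + tau^2*(eta3*f00 + eta6*f01 + eta8*f10
                 + g0*omega3 + g1*omega9 + g2*omega14 + g3*omega17)*mu
        + tau^3*(g0*omega2 + g1*omega7 + g2*omega13 + f00*eta2 + f01/6))*c0
       + c1*(eta4*f00 + g0*omega4 + g1*omega10 + g2*omega15)*mu^2
       + g1*omega8*mu*c2
       + c1*(eta1*f00 + g0*omega1 + g1*omega6 + g2*omega12)*tau^2
       + g0*c3)*h^3).

(* Main.v *)
Require Import Defs.
From Stdlib Require Import Reals ZArith.
From Coquelicot Require Import Coquelicot.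
From Stdlib Require Import Lra Lia ClassicalEpsilon.
Open Scope R_scope.

(** A stencil point is [B + h (mu, tau)] with [B = (p t, q t)] on the boundary, so
    [u] there is a Taylor expansion at [B].  Of the derivatives of [u] at [B] up
    to order three only [u_y], [u_xy] and [u_xxy] are free: the boundary
    condition differentiated up to three times along the curve, and the equation
    with its two first derivatives, express the others through the data
    ([elim_ux], [elim_uxx], [elim_uxxx] and the equations for the remaining ones).
    Sorting [C u] by powers of [h], the data up to order [h^3] form exactly the
    right-hand side of the scheme, and the free derivatives are multiplied by the
    rows of the linear system ([expansion]), which sum to zero over the stencil.
    What remains are products of total order at least four and the Taylor
    remainder ([truncation_bound]).

    The analytic part is to justify that expansion.  The function [u] lives on
    the closure only, its derivatives at [B] are limits from inside, and the
    straight segment from [B] to a stencil point may leave the closure.  Near [B],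
    however, the domain is one side of a Lipschitz graph, so [B] and any nearby
    point of the closure are joined, through the domain, by three axis-parallel
    segments no longer than a multiple of their distance ([boundary_joined]).
    Along such a path the mean value theorem bounds Taylor remainders of every
    order by induction ([remainder_path]), and compactness of a box makes the
    constants uniform in [B] ([uniform_taylor]).  The second-order case also gives
    the chain rule along the boundary curve ([boundary_chain_rule]), hence the
    right to differentiate [u (p t) (q t) = g t].

    Finally [mu] and [tau] are bounded: the stencil of an irregular center leaves
    the closure, so it crosses the boundary, and the projection of the center is
    not farther away than that crossing ([irregular_center_near_boundary]). *)

(** * Limits from inside a domain *)

Definition cont_on_closure (Om : R * R -> Prop) (F : R * R -> R) : Prop :=
  forall B, closure Om B ->
    filterlim F (within (closure Om) (locally B)) (locally (F B)).

(** Inside [Om] the partial derivatives are classical; on the boundary [Fx] and [Fy]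
    are fixed by continuity only, hence they are part of the data. *)
Definition C1_closure (Om : R * R -> Prop) (F Fx Fy : R * R -> R) : Prop :=
  cont_on_closure Om F /\ cont_on_closure Om Fx /\ cont_on_closure Om Fy /\
  forall x y, Om (x, y) ->
    is_derive (fun s => F (s, y)) x (Fx (x, y)) /\
    is_derive (fun s => F (x, s)) y (Fy (x, y)).

(** A function with its partial derivatives up to the boundary, as in Whitney's
    extension theory: the values at a boundary point form a Taylor polynomial. *)
Definition jet (Om : R * R -> Prop) (k : nat) (F : nat -> nat -> R * R -> R) : Prop :=
  forall m n, (m + n < k)%nat -> C1_closure Om (F m n) (F (S m) n) (F m (S n)).

Lemma ball_plane (P Q : R * R) (e : R) :
  ball P e Q <-> Rabs (fst Q - fst P) < e /\ Rabs (snd Q - snd P) < e.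
Proof. destruct P, Q; split; exact (fun H => H). Qed.

Lemma domain_in_closure (Om : R * R -> Prop) P : Om P -> closure Om P.
Proof. intros H eps; exists P; split; [exact H | apply ball_center]. Qed.

Lemma within_closure_le (Om : R * R -> Prop) (B : R * R) :
  filter_le (within Om (locally B)) (within (closure Om) (locally B)).
Proof.
  intros Q HQ. unfold within in *. eapply filter_imp; [|exact HQ].
  intros x Hx Ox; apply Hx; now apply domain_in_closure.
Qed.

Lemma cont_from_inside (Om : R * R -> Prop) F B : cont_on_closure Om F -> closure Om B ->
  filterlim F (within Om (locally B)) (locally (F B)).
Proof.
  intros HF HB. eapply filterlim_filter_le_1; [apply within_closure_le | now apply HF].
Qed.

Lemma proper_from_inside (Om : R * R -> Prop) (B : R * R) :
  closure Om B -> ProperFilter (within Om (locally B)).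
Proof.
  intros HB; split.
  - intros Q [eps HQ]. destruct (HB eps) as [X [OX BX]].
    exists X; now apply HQ.
  - apply within_filter, locally_filter.
Qed.

Lemma lim_unique {T} (F : (T -> Prop) -> Prop) (f : T -> R) (l : R) :
  ProperFilter F -> filterlim f F (locally l) -> lim (filtermap f F) = l.
Proof.
  intros PF Hf.
  assert (PG : ProperFilter (filtermap f F)) by (apply filtermap_proper_filter; auto).
  assert (HC : cauchy (filtermap f F)).
  { intros eps; exists l. apply Hf. exists eps; auto. }
  apply eq_close; intros eps.
  assert (H1 := complete_cauchy _ _ HC (pos_div_2 eps)).
  assert (H2 : filtermap f F (ball l (pos_div_2 eps))) by (apply Hf; now exists (pos_div_2 eps)).
  destruct (filter_ex _ (filter_and _ _ H1 H2)) as [x [Hx1 Hx2]].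
  replace (pos eps) with (pos_div_2 eps + pos_div_2 eps) by (simpl; field).
  eapply ball_triangle; [exact Hx1 | now apply ball_sym].
Qed.

Lemma pd_limit (Om : R * R -> Prop) m n f x y l : closure Om (x, y) ->
  filterlim (fun P => partial_derive m n f (fst P) (snd P))
    (within Om (locally (x, y))) (locally l) -> pd Om m n f x y = l.
Proof.
  intros HB Hl. unfold pd. apply lim_unique; [now apply proper_from_inside | exact Hl].
Qed.

Lemma open_locally_2d (Om : R * R -> Prop) x y (Pr : R -> R -> Prop) : open Om -> Om (x, y) ->
  (forall a b, Om (a, b) -> Pr a b) -> locally_2d Pr x y.
Proof.
  intros HO Hxy H. apply locally_2d_locally. eapply filter_imp; [|exact (HO _ Hxy)].
  intros [a b]; apply H.
Qed.

Lemma unif_cont_cont_on_closure (Om : R * R -> Prop) F :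
  unif_cont_on (closure Om) F -> cont_on_closure Om F.
Proof.
  intros HF B HB Q [eps HQ]. destruct (HF eps) as [d Hd].
  exists d. intros X HX CX. apply HQ. now apply Hd.
Qed.

Section PD.
Variables (Om : R * R -> Prop) (k : nat) (f : R -> R -> R).
Hypothesis OmO : open Om.
Hypothesis reg : Ck_closure Om k f.

Lemma partial_derive_cont m n x y : (m + n <= k)%nat -> Om (x, y) ->
  continuity_2d_pt (partial_derive m n f) x y.
Proof.
  intros Hk Hxy. destruct reg as [H _].
  assert (E := ex_diff_n_deriv k m n Hk f x y (H x y Hxy)).
  destruct (k - (m + n))%nat; apply E.
Qed.

Lemma pd_inside m n x y : (m + n <= k)%nat -> Om (x, y) ->
  pd Om m n f x y = partial_derive m n f x y.
Proof.
  intros Hk Hxy. apply pd_limit; [now apply domain_in_closure|].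
  eapply filterlim_filter_le_1; [apply filter_le_within|].
  apply (proj1 (continuity_2d_pt_filterlim (partial_derive m n f) x y)).
  now apply partial_derive_cont.
Qed.

(** The derivative in [y] uses the symmetry of second derivatives, because
    [partial_derive m n] differentiates in [y] first. *)
Lemma jet_pd : jet Om k (fun m n P => pd Om m n f (fst P) (snd P)).
Proof.
  destruct reg as [H1 [H2 _]].
  intros m n Hmn.
  split; [|split; [|split]]; try (apply unif_cont_cont_on_closure, H2; lia).
  intros x y H; split.
  - simpl. rewrite pd_inside; [|lia|auto].
    apply (is_derive_ext_loc (fun s => partial_derive m n f s y)).
    + apply (locally_2d_1d_const_y (fun a b => partial_derive m n f a b = pd Om m n f a b)).
      apply (open_locally_2d Om); auto.
      intros a b Hab; symmetry; apply pd_inside; [lia | exact Hab].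
    + apply Derive_correct. now apply (ex_diff_n_ex_deriv_inf_1 k m n Hmn f x y), H1.
  - simpl. rewrite pd_inside; [|lia|auto].
    apply (is_derive_ext_loc (fun s => partial_derive m n f x s)).
    + apply (locally_2d_1d_const_x (fun a b => partial_derive m n f a b = pd Om m n f a b)).
      apply (open_locally_2d Om); auto.
      intros a b Hab; symmetry; apply pd_inside; [lia | exact Hab].
    + rewrite <- (Derive_partial_derive m n f x y).
      * apply Derive_correct. now apply (ex_diff_n_ex_deriv_inf_2 k m n Hmn f x y), H1.
      * apply (open_locally_2d Om); auto. intros a b Hab.
        apply ex_diff_n_m with k; [lia | auto].
Qed.
End PD.

(** * Functions that are C^1 up to the boundary *)
Section Calculus.
Variable Om : R * R -> Prop.
Hypothesis OmO : open Om.

Lemma cont_const (c : R) : cont_on_closure Om (fun _ => c).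
Proof. intros B _. apply filterlim_const. Qed.

Lemma cont_fst : cont_on_closure Om fst.
Proof.
  intros [x y] _. eapply filterlim_filter_le_1; [apply filter_le_within|].
  apply (continuous_fst x y).
Qed.

Lemma cont_snd : cont_on_closure Om snd.
Proof.
  intros [x y] _. eapply filterlim_filter_le_1; [apply filter_le_within|].
  apply (continuous_snd x y).
Qed.

Lemma cont_plus F G : cont_on_closure Om F -> cont_on_closure Om G ->
  cont_on_closure Om (fun P => F P + G P).
Proof.
  intros HF HG B HB. eapply filterlim_comp_2; [now apply HF | now apply HG |].
  apply (filterlim_plus (F B) (G B)).
Qed.

Lemma cont_mult F G : cont_on_closure Om F -> cont_on_closure Om G ->
  cont_on_closure Om (fun P => F P * G P).
Proof.
  intros HF HG B HB. eapply filterlim_comp_2; [now apply HF | now apply HG |].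
  apply (filterlim_mult (F B) (G B)).
Qed.

Lemma cont_inv F : (forall P, closure Om P -> F P <> 0) -> cont_on_closure Om F ->
  cont_on_closure Om (fun P => / F P).
Proof.
  intros H0 HF B HB. eapply filterlim_comp; [now apply HF |].
  apply (proj1 (continuity_pt_filterlim Rinv (F B))).
  apply continuity_pt_inv; [apply continuity_pt_id | now apply H0].
Qed.

Lemma cont_ext F G : (forall P, closure Om P -> F P = G P) ->
  cont_on_closure Om F -> cont_on_closure Om G.
Proof.
  intros E H B HB. rewrite <- (E B HB).
  eapply filterlim_within_ext; [exact E | now apply H].
Qed.

Lemma C1_const (c : R) : C1_closure Om (fun _ => c) (fun _ => 0) (fun _ => 0).
Proof.
  split; [|split; [|split]]; try apply cont_const.
  intros x y _; split; apply (is_derive_const c).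
Qed.

Lemma C1_ext F Fx Fy G Gx Gy :
  (forall P, closure Om P -> F P = G P) ->
  (forall P, closure Om P -> Fx P = Gx P) ->
  (forall P, closure Om P -> Fy P = Gy P) ->
  C1_closure Om F Fx Fy -> C1_closure Om G Gx Gy.
Proof.
  intros E Ex Ey [H [Hx [Hy HD]]].
  split; [|split; [|split]];
    [now apply (cont_ext F) | now apply (cont_ext Fx) | now apply (cont_ext Fy) |].
  intros x y Hxy. destruct (HD x y Hxy) as [Dx Dy].
  assert (L : locally_2d (fun a b => F (a, b) = G (a, b)) x y).
  { apply (open_locally_2d Om); auto. intros; now apply E, domain_in_closure. }
  rewrite <- Ex, <- Ey by now apply domain_in_closure. split.
  - eapply is_derive_ext_loc; [|exact Dx].
    now apply (locally_2d_1d_const_y (fun a b => F (a, b) = G (a, b))).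
  - eapply is_derive_ext_loc; [|exact Dy].
    now apply (locally_2d_1d_const_x (fun a b => F (a, b) = G (a, b))).
Qed.

Lemma C1_plus F Fx Fy G Gx Gy :
  C1_closure Om F Fx Fy -> C1_closure Om G Gx Gy ->
  C1_closure Om (fun P => F P + G P) (fun P => Fx P + Gx P) (fun P => Fy P + Gy P).
Proof.
  intros [F0 [F1 [F2 F3]]] [G0 [G1 [G2 G3]]].
  split; [|split; [|split]]; try now apply cont_plus.
  intros x y H; destruct (F3 x y H), (G3 x y H).
  split; now apply @is_derive_plus.
Qed.

Lemma C1_mult F Fx Fy G Gx Gy :
  C1_closure Om F Fx Fy -> C1_closure Om G Gx Gy ->
  C1_closure Om (fun P => F P * G P)
    (fun P => Fx P * G P + F P * Gx P) (fun P => Fy P * G P + F P * Gy P).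
Proof.
  intros [F0 [F1 [F2 F3]]] [G0 [G1 [G2 G3]]].
  split; [|split; [|split]]; try now repeat first [apply cont_plus | apply cont_mult].
  intros x y H; destruct (F3 x y H), (G3 x y H).
  split.
  - apply (is_derive_mult (fun s => F (s, y)) (fun s => G (s, y))); auto. exact Rmult_comm.
  - apply (is_derive_mult (fun s => F (x, s)) (fun s => G (x, s))); auto. exact Rmult_comm.
Qed.

Lemma C1_scal c F Fx Fy : C1_closure Om F Fx Fy ->
  C1_closure Om (fun P => c * F P) (fun P => c * Fx P) (fun P => c * Fy P).
Proof.
  intros H.
  eapply C1_ext; [| | |exact (C1_mult _ _ _ _ _ _ (C1_const c) H)]; intros P _; simpl; ring.
Qed.

Lemma C1_minus F Fx Fy G Gx Gy :
  C1_closure Om F Fx Fy -> C1_closure Om G Gx Gy ->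
  C1_closure Om (fun P => F P - G P) (fun P => Fx P - Gx P) (fun P => Fy P - Gy P).
Proof.
  intros [F0 [F1 [F2 F3]]] [G0 [G1 [G2 G3]]].
  assert (K : forall A B, cont_on_closure Om A -> cont_on_closure Om B ->
    cont_on_closure Om (fun P => A P - B P)).
  { intros A B HA HB. apply (cont_ext (fun P => A P + (-1) * B P)); [intros; ring|].
    apply cont_plus, cont_mult; auto using cont_const. }
  split; [|split; [|split]]; try now apply K.
  intros x y H; destruct (F3 x y H), (G3 x y H).
  split; now apply @is_derive_minus.
Qed.

Lemma C1_div F Fx Fy G Gx Gy : (forall P, closure Om P -> G P <> 0) ->
  C1_closure Om F Fx Fy -> C1_closure Om G Gx Gy ->
  C1_closure Om (fun P => F P / G P)
    (fun P => (Fx P * G P - F P * Gx P) / G P ^ 2)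
    (fun P => (Fy P * G P - F P * Gy P) / G P ^ 2).
Proof.
  intros G_neq0 [F0 [F1 [F2 F3]]] [G0 [G1 [G2 G3]]].
  assert (K : forall A B, cont_on_closure Om A -> cont_on_closure Om B ->
    cont_on_closure Om (fun P => (A P * G P - F P * B P) / G P ^ 2)).
  { intros A B HA HB.
    apply (cont_ext (fun P => (A P * G P + (-1) * (F P * B P)) * / (G P * G P))).
    { intros P _; simpl. rewrite Rmult_1_r. unfold Rdiv; ring. }
    apply cont_mult.
    - repeat first [apply cont_plus | apply cont_mult | apply cont_const]; auto.
    - apply cont_inv; [|now apply cont_mult].
      intros P HP; apply Rmult_integral_contrapositive; auto. }
  split; [|split; [|split]]; try now apply K.
  - apply cont_mult; [|apply cont_inv]; auto.
  - intros x y H; destruct (F3 x y H), (G3 x y H).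
    assert (G (x, y) <> 0) by now apply G_neq0, domain_in_closure.
    split.
    + apply (is_derive_div (fun s => F (s, y)) (fun s => G (s, y))); auto.
    + apply (is_derive_div (fun s => F (x, s)) (fun s => G (x, s))); auto.
Qed.

(** Boundary points are limits of points of the domain, so identities between
    continuous functions extend to them. *)
Lemma cont_inside_eq F G : cont_on_closure Om F -> cont_on_closure Om G ->
  (forall P, Om P -> F P = G P) -> forall P, closure Om P -> F P = G P.
Proof.
  intros HF HG E P HP.
  assert (PF := proper_from_inside Om P HP).
  apply (filterlim_locally_unique (F := within Om (locally P)) F).
  - now apply cont_from_inside.
  - apply (filterlim_within_ext Om G); [|now apply cont_from_inside].
    intros X HX; symmetry; now apply E.
Qed.

Lemma C1_pd (f : R -> R -> R) Fx Fy x y :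
  C1_closure Om (fun P => f (fst P) (snd P)) Fx Fy -> closure Om (x, y) ->
  pd Om 1 0 f x y = Fx (x, y) /\ pd Om 0 1 f x y = Fy (x, y).
Proof.
  intros [H0 [H1 [H2 H3]]] HB; split; apply pd_limit; auto.
  - eapply filterlim_within_ext; [|now apply cont_from_inside, HB].
    intros [a b] HX; symmetry. apply is_derive_unique, (H3 a b HX).
  - eapply filterlim_within_ext; [|now apply cont_from_inside, HB].
    intros [a b] HX; symmetry. apply is_derive_unique, (H3 a b HX).
Qed.

(** An equation may be differentiated in the open domain, and the differentiated
    equations persist on the boundary by continuity. *)
Lemma C1_vanish F Fx Fy : C1_closure Om F Fx Fy -> (forall P, Om P -> F P = 0) ->
  forall P, closure Om P -> F P = 0 /\ Fx P = 0 /\ Fy P = 0.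
Proof.
  intros [H0 [H1 [H2 H3]]] E P HP.
  assert (K : forall x y, Om (x, y) -> Fx (x, y) = 0 /\ Fy (x, y) = 0).
  { intros x y Hxy. destruct (H3 x y Hxy) as [D1 D2].
    assert (L : locally_2d (fun a b => F (a, b) = 0) x y)
      by (apply (open_locally_2d Om); auto).
    split.
    - transitivity (Derive (fun s => F (s, y)) x);
        [symmetry; now apply is_derive_unique|].
      rewrite (Derive_ext_loc _ (fun _ => 0)); [apply Derive_const|].
      now apply (locally_2d_1d_const_y (fun a b => F (a, b) = 0)).
    - transitivity (Derive (fun s => F (x, s)) y);
        [symmetry; now apply is_derive_unique|].
      rewrite (Derive_ext_loc _ (fun _ => 0)); [apply Derive_const|].
      now apply (locally_2d_1d_const_x (fun a b => F (a, b) = 0)). }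
  repeat split; revert P HP; apply (cont_inside_eq _ (fun _ => 0)); auto using cont_const;
    intros [x y] HP; now apply K.
Qed.

Lemma C1_self (f : R -> R -> R) Fx Fy :
  C1_closure Om (fun P => f (fst P) (snd P)) Fx Fy ->
  C1_closure Om (fun P => f (fst P) (snd P))
    (fun P => pd Om 1 0 f (fst P) (snd P)) (fun P => pd Om 0 1 f (fst P) (snd P)).
Proof.
  intros H. eapply C1_ext; [| | |exact H]; auto;
    intros [x y] HP; symmetry; now apply (C1_pd f Fx Fy).
Qed.

Lemma C1_of_Ck (k : nat) (f : R -> R -> R) : (1 <= k)%nat -> Ck_closure Om k f ->
  C1_closure Om (fun P => f (fst P) (snd P))
    (fun P => pd Om 1 0 f (fst P) (snd P)) (fun P => pd Om 0 1 f (fst P) (snd P)).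
Proof.
  intros Hk Hf. eapply C1_ext; [| | |exact (jet_pd Om k f OmO Hf 0%nat 0%nat ltac:(lia))]; auto.
  intros [x y] HP; now apply Hf.
Qed.
End Calculus.

(** * The equation and its first derivatives on the closure *)
Section Equation.
Variables (Om : R * R -> Prop) (alpha beta1 beta2 kappa phi u : R -> R -> R).
Hypothesis OmO : open Om.
Hypothesis alpha_reg : Ck_closure Om 2 alpha.
Hypothesis beta1_reg : Ck_closure Om 2 beta1.
Hypothesis beta2_reg : Ck_closure Om 2 beta2.
Hypothesis kappa_reg : Ck_closure Om 2 kappa.
Hypothesis phi_reg : Ck_closure Om 2 phi.
Hypothesis u_reg : Ck_closure Om 4 u.
Hypothesis alpha_pos : forall x y : R, closure Om (x, y) -> 0 < alpha x y.
Hypothesis u_sol : elliptic_eq Om alpha beta1 beta2 kappa phi u.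

Let a := red_a Om alpha beta1.
Let b := red_b Om alpha beta2.
Let d := red_d alpha kappa.
Let f := red_f alpha phi.

Let alpha_neq0 (P : R * R) : closure Om P -> alpha (fst P) (snd P) <> 0.
Proof. destruct P as [x y]; intros H; apply Rgt_not_eq, (alpha_pos x y H). Qed.

Lemma C1_red_a : C1_closure Om (fun P => a (fst P) (snd P))
  (fun P => pd Om 1 0 a (fst P) (snd P)) (fun P => pd Om 0 1 a (fst P) (snd P)).
Proof.
  eapply C1_self, C1_div; auto; [apply C1_minus|]; eauto using C1_of_Ck.
  apply (jet_pd Om 2 alpha OmO alpha_reg 1%nat 0%nat); lia.
Qed.

Lemma C1_red_b : C1_closure Om (fun P => b (fst P) (snd P))
  (fun P => pd Om 1 0 b (fst P) (snd P)) (fun P => pd Om 0 1 b (fst P) (snd P)).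
Proof.
  eapply C1_self, C1_div; auto; [apply C1_minus|]; eauto using C1_of_Ck.
  apply (jet_pd Om 2 alpha OmO alpha_reg 0%nat 1%nat); lia.
Qed.

Lemma C1_opp_div (F : R -> R -> R) : Ck_closure Om 2 F ->
  let r := fun x y => - (F x y / alpha x y) in
  C1_closure Om (fun P => r (fst P) (snd P))
  (fun P => pd Om 1 0 r (fst P) (snd P)) (fun P => pd Om 0 1 r (fst P) (snd P)).
Proof.
  intros HF r. eapply C1_self; auto.
  eapply (C1_ext Om OmO (fun P => (-1) * (F (fst P) (snd P) / alpha (fst P) (snd P))));
    [intros; unfold r; ring | reflexivity | reflexivity |].
  apply C1_scal; auto. apply C1_div; eauto using C1_of_Ck.
Qed.

Lemma reduced_equation_inside x y : Om (x, y) ->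
  pd Om 2 0 u x y + pd Om 0 2 u x y + a x y * pd Om 1 0 u x y
  + b x y * pd Om 0 1 u x y + d x y * u x y - f x y = 0.
Proof.
  intros Hxy. assert (E := u_sol x y Hxy).
  assert (A : alpha x y <> 0) by (apply (alpha_neq0 (x, y)), domain_in_closure, Hxy).
  unfold a, b, d, f, red_a, red_b, red_d, red_f.
  rewrite !(pd_inside Om 4 u), !(pd_inside Om 2 alpha) by (auto; lia).
  destruct alpha_reg as [Ha _]. destruct u_reg as [Hu _].
  assert (E1 : partial_derive 1 0 (fun x y => alpha x y * partial_derive 1 0 u x y) x y
    = partial_derive 1 0 alpha x y * partial_derive 1 0 u x y
      + alpha x y * partial_derive 2 0 u x y).
  { apply (Derive_mult (fun s => alpha s y) (fun s => partial_derive 1 0 u s y)).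
    - exact (ex_diff_n_ex_deriv_inf_1 2 0 0 ltac:(lia) alpha x y (Ha x y Hxy)).
    - exact (ex_diff_n_ex_deriv_inf_1 4 1 0 ltac:(lia) u x y (Hu x y Hxy)). }
  assert (E2 : partial_derive 0 1 (fun x y => alpha x y * partial_derive 0 1 u x y) x y
    = partial_derive 0 1 alpha x y * partial_derive 0 1 u x y
      + alpha x y * partial_derive 0 2 u x y).
  { apply (Derive_mult (fun s => alpha x s) (fun s => partial_derive 0 1 u x s)).
    - exact (ex_diff_n_ex_deriv_inf_2 2 0 0 ltac:(lia) alpha x y (Ha x y Hxy)).
    - exact (ex_diff_n_ex_deriv_inf_2 4 0 1 ltac:(lia) u x y (Hu x y Hxy)). }
  rewrite E1, E2 in E. rewrite <- E. field. exact A.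
Qed.

(** The left side of the reduced equation is one function of class C^1 up to the
    boundary, to which [C1_vanish] applies. *)
Lemma reduced_equation_closure x y : closure Om (x, y) ->
  pd Om 2 0 u x y + pd Om 0 2 u x y + a x y * pd Om 1 0 u x y
  + b x y * pd Om 0 1 u x y + d x y * u x y - f x y = 0
  /\
  pd Om 3 0 u x y + pd Om 1 2 u x y
  + (pd Om 1 0 a x y * pd Om 1 0 u x y + a x y * pd Om 2 0 u x y)
  + (pd Om 1 0 b x y * pd Om 0 1 u x y + b x y * pd Om 1 1 u x y)
  + (pd Om 1 0 d x y * u x y + d x y * pd Om 1 0 u x y) - pd Om 1 0 f x y = 0
  /\
  pd Om 2 1 u x y + pd Om 0 3 u x y
  + (pd Om 0 1 a x y * pd Om 1 0 u x y + a x y * pd Om 1 1 u x y)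
  + (pd Om 0 1 b x y * pd Om 0 1 u x y + b x y * pd Om 0 2 u x y)
  + (pd Om 0 1 d x y * u x y + d x y * pd Om 0 1 u x y) - pd Om 0 1 f x y = 0.
Proof.
  intros HP.
  assert (J := jet_pd Om 4 u OmO u_reg).
  assert (C := C1_minus Om _ _ _ _ _ _
    (C1_plus Om _ _ _ _ _ _ (C1_plus Om _ _ _ _ _ _ (C1_plus Om _ _ _ _ _ _
      (C1_plus Om _ _ _ _ _ _ (J 2%nat 0%nat ltac:(lia)) (J 0%nat 2%nat ltac:(lia)))
      (C1_mult Om _ _ _ _ _ _ C1_red_a (J 1%nat 0%nat ltac:(lia))))
      (C1_mult Om _ _ _ _ _ _ C1_red_b (J 0%nat 1%nat ltac:(lia))))
      (C1_mult Om _ _ _ _ _ _ (C1_opp_div kappa kappa_reg)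
         (C1_of_Ck Om OmO 4 u ltac:(lia) u_reg)))
    (C1_opp_div phi phi_reg)).
  apply (fun H => C1_vanish Om OmO _ _ _ C H (x, y) HP).
  intros [s t] H. apply (reduced_equation_inside s t H).
Qed.
End Equation.

(** * Axis-parallel paths *)

Definition along (P Q : R * R) (s : R) : R * R :=
  (fst P + s * (fst Q - fst P), snd P + s * (snd Q - snd P)).

Definition supd (P Q : R * R) : R :=
  Rmax (Rabs (fst Q - fst P)) (Rabs (snd Q - snd P)).

(** A degenerate segment may sit on the boundary, hence the restriction [P <> Q]. *)
Definition axis_seg (Om : R * R -> Prop) (P Q : R * R) : Prop :=
  closure Om P /\ closure Om Q /\ (fst P = fst Q \/ snd P = snd Q) /\
  forall s, P <> Q -> 0 < s < 1 -> Om (along P Q s).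

Lemma supd_pos P Q : 0 <= supd P Q.
Proof. eapply Rle_trans; [apply Rabs_pos | apply Rmax_l]. Qed.

Lemma supd_fst P Q : Rabs (fst Q - fst P) <= supd P Q.
Proof. apply Rmax_l. Qed.

Lemma supd_snd P Q : Rabs (snd Q - snd P) <= supd P Q.
Proof. apply Rmax_r. Qed.

Lemma supd_le P Q e :
  Rabs (fst Q - fst P) <= e -> Rabs (snd Q - snd P) <= e -> supd P Q <= e.
Proof. apply Rmax_lub. Qed.

Lemma supd_ball (P Q : R * R) (e : R) : ball P e Q <-> supd P Q < e.
Proof.
  rewrite ball_plane. unfold supd. split; [intros []; now apply Rmax_lub_lt|].
  intros H; split; eapply Rle_lt_trans; try exact H; [apply Rmax_l | apply Rmax_r].
Qed.

Lemma supd_sym P Q : supd P Q = supd Q P.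
Proof. unfold supd. now rewrite (Rabs_minus_sym (fst Q)), (Rabs_minus_sym (snd Q)). Qed.

Lemma supd_triangle P Q S : supd P S <= supd P Q + supd Q S.
Proof.
  apply supd_le.
  - replace (fst S - fst P) with ((fst Q - fst P) + (fst S - fst Q)) by ring.
    eapply Rle_trans; [apply Rabs_triang|]. apply Rplus_le_compat; apply supd_fst.
  - replace (snd S - snd P) with ((snd Q - snd P) + (snd S - snd Q)) by ring.
    eapply Rle_trans; [apply Rabs_triang|]. apply Rplus_le_compat; apply supd_snd.
Qed.

Lemma along_0 P Q : along P Q 0 = P.
Proof. destruct P; unfold along; simpl; f_equal; ring. Qed.

Lemma along_1 P Q : along P Q 1 = Q.
Proof. destruct P, Q; unfold along; simpl; f_equal; ring. Qed.

Lemma supd_along P Q s t : supd (along P Q s) (along P Q t) = Rabs (t - s) * supd P Q.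
Proof.
  unfold supd, along; simpl. rewrite <- RmaxRmult by apply Rabs_pos.
  rewrite <- !Rabs_mult. f_equal; f_equal; ring.
Qed.

Lemma along_same P s : along P P s = P.
Proof. destruct P; unfold along; simpl; f_equal; ring. Qed.

Lemma axis_seg_closure Om P Q s : axis_seg Om P Q -> 0 <= s <= 1 ->
  closure Om (along P Q s).
Proof.
  intros [HP [HQ [_ H]]] Hs.
  destruct (Req_dec s 0) as [->|]; [now rewrite along_0|].
  destruct (Req_dec s 1) as [->|]; [now rewrite along_1|].
  destruct (excluded_middle_informative (P = Q)) as [->|PQ]; [now rewrite along_same|].
  apply domain_in_closure, H; [exact PQ | lra].
Qed.

(** The mean value theorem needs continuity at the ends of the segment from
    both sides, so the function is first made constant beyond them. *)
Lemma axis_seg_increment Om F Fx Fy P Q M : C1_closure Om F Fx Fy ->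
  axis_seg Om P Q ->
  (forall s, 0 <= s <= 1 ->
     Rabs (Fx (along P Q s)) <= M /\ Rabs (Fy (along P Q s)) <= M) ->
  forall t, 0 <= t <= 1 -> Rabs (F (along P Q t) - F P) <= M * supd P Q.
Proof.
  intros [F0 [_ [_ F3]]] HS HM t Ht.
  destruct (excluded_middle_informative (P = Q)) as [<-|PQ].
  { rewrite along_same, Rminus_diag, Rabs_R0. apply Rmult_le_pos; [|apply supd_pos].
    eapply Rle_trans; [apply Rabs_pos | apply (HM 0); lra]. }
  set (clamp := fun s => Rmax 0 (Rmin 1 s)).
  assert (Hc : forall s, 0 <= clamp s <= 1).
  { intros s; unfold clamp; split; [apply Rmax_l|].
    apply Rmax_lub; [lra | apply Rmin_l]. }
  assert (Hi : forall s, 0 <= s <= 1 -> clamp s = s).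
  { intros s Hs; unfold clamp. rewrite Rmin_right, Rmax_right; lra. }
  assert (Hl : forall s s', Rabs (clamp s' - clamp s) <= Rabs (s' - s)).
  { intros s s'; unfold clamp, Rmax, Rmin.
    repeat destruct (Rle_dec _ _); unfold Rabs; repeat destruct (Rcase_abs _); lra. }
  set (G := fun s => F (along P Q (clamp s))).
  set (dG := fun s => Fx (along P Q s) * (fst Q - fst P)
                      + Fy (along P Q s) * (snd Q - snd P)).
  assert (HG : forall s, continuity_pt G s).
  { intros s. apply continuity_pt_filterlim. intros V HV.
    assert (HB : closure Om (along P Q (clamp s))) by (now apply axis_seg_closure).
    destruct (F0 _ HB V HV) as [e He].
    set (K := supd P Q + 1).
    assert (HK : 0 < K) by (unfold K; generalize (supd_pos P Q); lra).
    assert (HeK : 0 < e / K) by (apply Rdiv_lt_0_compat; [apply e | exact HK]).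
    exists (mkposreal _ HeK). intros s' Hs'.
    apply He; [|now apply axis_seg_closure].
    apply supd_ball. rewrite supd_along.
    change (Rabs (s' - s) < e / K) in Hs'.
    apply Rle_lt_trans with (Rabs (s' - s) * K).
    - apply Rmult_le_compat; auto using Rabs_pos, supd_pos. unfold K; lra.
    - apply Rlt_div_r in Hs'; auto. }
  assert (HdG : forall s, 0 < s < 1 -> is_derive G s (dG s)).
  { intros s Hs.
    apply (is_derive_ext_loc (fun s => F (along P Q s))).
    { assert (He : 0 < Rmin s (1 - s)) by (apply Rmin_glb_lt; lra).
      exists (mkposreal _ He). intros s' Hs'. unfold G. rewrite Hi; auto.
      change (Rabs (s' - s) < Rmin s (1 - s)) in Hs'.
      generalize (Rmin_l s (1 - s)) (Rmin_r s (1 - s)).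
      apply Rabs_def2 in Hs'. lra. }
    destruct HS as [_ [_ [Hax HO]]].
    specialize (HO s PQ Hs). unfold dG. destruct (F3 _ _ HO) as [D1 D2].
    assert (Dl : forall c e, is_derive (fun s => c + s * (e - c)) s (e - c))
      by (intros c e; auto_derive; auto; ring).
    destruct Hax as [Hax|Hax]; rewrite Hax, Rminus_diag, Rmult_0_r.
    - rewrite Rplus_0_l, Rmult_comm.
      apply (is_derive_ext (fun s' => F (fst P + s * (fst Q - fst P), snd P + s' * (snd Q - snd P)))).
      { intros s'; unfold along; rewrite Hax; f_equal; f_equal; ring. }
      apply (is_derive_comp (fun z => F (fst P + s * (fst Q - fst P), z))
               (fun s => snd P + s * (snd Q - snd P))); [exact D2 | apply Dl].
    - rewrite Rplus_0_r, Rmult_comm.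
      apply (is_derive_ext (fun s' => F (fst P + s' * (fst Q - fst P), snd P + s * (snd Q - snd P)))).
      { intros s'; unfold along; rewrite Hax; f_equal; f_equal; ring. }
      apply (is_derive_comp (fun z => F (z, snd P + s * (snd Q - snd P)))
               (fun s => fst P + s * (fst Q - fst P))); [exact D1 | apply Dl]. }
  destruct (MVT_gen G 0 t dG) as [c [Hc1 Hc2]].
  - intros s Hs. rewrite Rmin_left, Rmax_right in Hs by lra. apply HdG. lra.
  - intros s _. apply HG.
  - rewrite Rmin_left, Rmax_right in Hc1 by lra.
    unfold G in Hc2. rewrite !Hi, along_0 in Hc2 by lra. rewrite Hc2.
    rewrite Rminus_0_r, Rabs_mult, (Rabs_pos_eq t) by lra.
    destruct (HM c ltac:(lra)) as [M1 M2].
    assert (0 <= M) by (eapply Rle_trans; [apply Rabs_pos | exact M1]).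
    assert (Hd : Rabs (dG c) <= M * supd P Q).
    { unfold dG. destruct HS as [_ [_ [[Hax|Hax] _]]]; rewrite Hax, Rminus_diag, Rmult_0_r.
      - rewrite Rplus_0_l, Rabs_mult.
        apply Rmult_le_compat; auto using Rabs_pos, supd_snd.
      - rewrite Rplus_0_r, Rabs_mult.
        apply Rmult_le_compat; auto using Rabs_pos, supd_fst. }
    rewrite <- (Rmult_1_r (M * supd P Q)).
    apply Rmult_le_compat; auto using Rabs_pos; lra.
Qed.

(** * Taylor remainders along a path *)

(** The homogeneous Taylor term of degree [j], that is the sum over [a + b = j] of
    [c (m + a) (n + b) * dx^a * dy^b / (a! b!)].  Euler's identity for homogeneous
    functions gives this recursion, in which both partial derivatives are visible. *)
Fixpoint taylor_term (c : nat -> nat -> R) (j m n : nat) (dx dy : R) : R :=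
  match j with
  | O => c m n
  | S i => (dx * taylor_term c i (S m) n dx dy + dy * taylor_term c i m (S n) dx dy) / INR (S i)
  end.

(** [k] counts the homogeneous terms: the degree of the polynomial is [k - 1]. *)
Fixpoint taylor (c : nat -> nat -> R) (k m n : nat) (dx dy : R) : R :=
  match k with
  | O => 0
  | S j => taylor c j m n dx dy + taylor_term c j m n dx dy
  end.

Lemma taylor_term_scal c h dx dy j : forall m n,
  taylor_term c j m n (h * dx) (h * dy) = h ^ j * taylor_term c j m n dx dy.
Proof.
  induction j as [|j IH]; intros m n; [simpl; ring|].
  cbn [taylor_term]. rewrite !IH. simpl pow. unfold Rdiv. ring.
Qed.

Lemma taylor_term_bound c K dx dy e j : 0 <= e -> Rabs dx <= e -> Rabs dy <= e ->
  forall m n, (forall m' n', (m' + n' = m + n + j)%nat -> Rabs (c m' n') <= K) ->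
  Rabs (taylor_term c j m n dx dy) <= K * (2 * e) ^ j.
Proof.
  intros He Hx Hy. induction j as [|j IH]; intros m n HK.
  - cbn [taylor_term pow]. rewrite Rmult_1_r. apply HK. lia.
  - cbn [taylor_term].
    assert (H1 := IH (S m) n ltac:(intros; apply HK; lia)).
    assert (H2 := IH m (S n) ltac:(intros; apply HK; lia)).
    set (A := taylor_term c j (S m) n dx dy) in *. set (B := taylor_term c j m (S n) dx dy) in *.
    assert (HN : 1 <= INR (S j)) by (rewrite S_INR; generalize (pos_INR j); lra).
    assert (Hs : Rabs (dx * A + dy * B) <= K * (2 * e) ^ S j).
    { replace (K * (2 * e) ^ S j)
        with (e * (K * (2 * e) ^ j) + e * (K * (2 * e) ^ j)) by (simpl; ring).
      eapply Rle_trans; [apply Rabs_triang|]. rewrite !Rabs_mult.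
      apply Rplus_le_compat; apply Rmult_le_compat; auto using Rabs_pos. }
    unfold Rdiv. rewrite Rabs_mult, (Rabs_pos_eq (/ INR (S j)))
      by (apply Rlt_le, Rinv_0_lt_compat; lra).
    apply Rle_trans with (Rabs (dx * A + dy * B) * 1); [|now rewrite Rmult_1_r].
    apply Rmult_le_compat_l; [apply Rabs_pos|].
    rewrite <- Rinv_1. apply Rinv_le_contravar; lra.
Qed.

Lemma taylor_term_at_0 c j m n : taylor_term c (S j) m n 0 0 = 0.
Proof. cbn [taylor_term]. unfold Rdiv; ring. Qed.

Lemma taylor_at_0 c k m n : taylor c (S k) m n 0 0 = c m n.
Proof.
  induction k as [|k IH]; [simpl; ring|].
  change (taylor c (S k) m n 0 0 + taylor_term c (S k) m n 0 0 = c m n).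
  rewrite IH, taylor_term_at_0; ring.
Qed.

Section Remainder.
Variable Om : R * R -> Prop.
Hypothesis OmO : open Om.

Lemma C1_fst_minus x0 : C1_closure Om (fun P => fst P - x0) (fun _ => 1) (fun _ => 0).
Proof.
  split; [|split; [|split]]; try apply cont_const.
  - apply (cont_ext Om (fun P => fst P + - x0)); [reflexivity|].
    apply cont_plus; [apply cont_fst | apply cont_const].
  - intros x y _; simpl; split; auto_derive; auto; ring.
Qed.

Lemma C1_snd_minus y0 : C1_closure Om (fun P => snd P - y0) (fun _ => 0) (fun _ => 1).
Proof.
  split; [|split; [|split]]; try apply cont_const.
  - apply (cont_ext Om (fun P => snd P + - y0)); [reflexivity|].
    apply cont_plus; [apply cont_snd | apply cont_const].
  - intros x y _; simpl; split; auto_derive; auto; ring.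
Qed.

(** The product rule yields one copy of the derivative from the factor [dx] (or
    [dy]) and [j] further copies from the terms of degree [j], by Euler's identity. *)
Lemma C1_taylor_term c x0 y0 j : forall m n,
  C1_closure Om (fun P => taylor_term c (S j) m n (fst P - x0) (snd P - y0))
    (fun P => taylor_term c j (S m) n (fst P - x0) (snd P - y0))
    (fun P => taylor_term c j m (S n) (fst P - x0) (snd P - y0)).
Proof.
  induction j as [|j IH]; intros m n.
  - eapply (C1_ext Om OmO);
      [| | |exact (C1_plus Om _ _ _ _ _ _
         (C1_scal Om OmO (c (S m) n) _ _ _ (C1_fst_minus x0))
         (C1_scal Om OmO (c m (S n)) _ _ _ (C1_snd_minus y0)))];
      intros P _; simpl; field.
  - eapply (C1_ext Om OmO);
      [| | |exact (C1_scal Om OmO (/ INR (S (S j))) _ _ _ (C1_plus Om _ _ _ _ _ _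
         (C1_mult Om _ _ _ _ _ _ (C1_fst_minus x0) (IH (S m) n))
         (C1_mult Om _ _ _ _ _ _ (C1_snd_minus y0) (IH m (S n)))))];
      intros P _; cbn [taylor_term]; rewrite ?(S_INR (S j));
      generalize (S_INR j) (pos_INR j); intros E H;
      try field; lra.
Qed.

Lemma C1_taylor c x0 y0 k : forall m n,
  C1_closure Om (fun P => taylor c (S k) m n (fst P - x0) (snd P - y0))
    (fun P => taylor c k (S m) n (fst P - x0) (snd P - y0))
    (fun P => taylor c k m (S n) (fst P - x0) (snd P - y0)).
Proof.
  induction k as [|k IH]; intros m n.
  - eapply (C1_ext Om OmO); [| | |exact (C1_const Om (c m n))]; intros P _; simpl; ring.
  - exact (C1_plus Om _ _ _ _ _ _ (IH m n) (C1_taylor_term c x0 y0 k m n)).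
Qed.

Definition remainder (F : nat -> nat -> R * R -> R) (B : R * R) (k m n : nat) (X : R * R) : R :=
  F m n X - taylor (fun m n => F m n B) k m n (fst X - fst B) (snd X - snd B).

Definition on_path (P P1 P2 Q X : R * R) : Prop :=
  exists s, 0 <= s <= 1 /\
    (X = along P P1 s \/ X = along P1 P2 s \/ X = along P2 Q s).

Definition path (Lam : R) (P P1 P2 Q : R * R) : Prop :=
  axis_seg Om P P1 /\ axis_seg Om P1 P2 /\ axis_seg Om P2 Q /\
  supd P P1 <= Lam /\ supd P1 P2 <= Lam /\ supd P2 Q <= Lam.

Definition joined (Lam : R) (P Q : R * R) : Prop :=
  exists P1 P2, path Lam P P1 P2 Q.

Lemma on_path_closure Lam P P1 P2 Q X : path Lam P P1 P2 Q -> on_path P P1 P2 Q X ->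
  closure Om X.
Proof.
  intros [S1 [S2 [S3 _]]] [s [Hs [-> | [-> | -> ] ]]]; eapply axis_seg_closure; eauto.
Qed.

Lemma on_path_supd Lam P P1 P2 Q X : path Lam P P1 P2 Q -> on_path P P1 P2 Q X ->
  supd P X <= 3 * Lam.
Proof.
  intros [_ [_ [_ [L1 [L2 L3]]]]] HX.
  assert (K : forall A B s, 0 <= s <= 1 -> supd A (along A B s) <= supd A B).
  { intros A B s Hs. rewrite <- (along_0 A B) at 1. rewrite supd_along, Rminus_0_r, Rabs_pos_eq by lra.
    generalize (supd_pos A B); intros; rewrite <- (Rmult_1_l (supd A B)) at 2.
    apply Rmult_le_compat_r; lra. }
  generalize (supd_pos P P1) (supd_triangle P P1 X) (supd_triangle P1 P2 X); intros.
  assert (0 <= Lam) by (eapply Rle_trans; [apply supd_pos | exact L1]).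
  destruct HX as [s [Hs [-> | [-> | -> ] ]]].
  - generalize (K P P1 s Hs); lra.
  - generalize (K P1 P2 s Hs); lra.
  - generalize (K P2 Q s Hs); lra.
Qed.

(** Each of the three segments adds at most [M * Lam]. *)
Lemma path_bound F Fx Fy Lam P P1 P2 Q M : C1_closure Om F Fx Fy ->
  path Lam P P1 P2 Q -> F P = 0 ->
  (forall X, on_path P P1 P2 Q X -> Rabs (Fx X) <= M /\ Rabs (Fy X) <= M) ->
  forall X, on_path P P1 P2 Q X -> Rabs (F X) <= M * (3 * Lam).
Proof.
  intros HF [S1 [S2 [S3 [L1 [L2 L3]]]]] H0 HM.
  assert (HM0 : 0 <= M).
  { eapply Rle_trans; [apply Rabs_pos|]. apply (HM P). exists 0; split; [lra|].
    left; symmetry; apply along_0. }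
  assert (HL0 : 0 <= Lam) by (eapply Rle_trans; [apply supd_pos | exact L1]).
  assert (HML := Rmult_le_pos _ _ HM0 HL0).
  assert (I1 : forall t, 0 <= t <= 1 -> Rabs (F (along P P1 t)) <= M * Lam).
  { intros t Ht. replace (F (along P P1 t)) with (F (along P P1 t) - F P) by (rewrite H0; ring).
    eapply Rle_trans; [eapply axis_seg_increment; eauto|].
    - intros s Hs; apply HM; exists s; auto.
    - now apply Rmult_le_compat_l. }
  assert (E1 := I1 1 ltac:(lra)); rewrite along_1 in E1.
  assert (I2 : forall t, 0 <= t <= 1 -> Rabs (F (along P1 P2 t)) <= 2 * (M * Lam)).
  { intros t Ht. replace (F (along P1 P2 t)) with ((F (along P1 P2 t) - F P1) + F P1) by ring.
    eapply Rle_trans; [apply Rabs_triang|].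
    assert (Rabs (F (along P1 P2 t) - F P1) <= M * Lam); [|lra].
    eapply Rle_trans; [eapply axis_seg_increment; eauto|].
    - intros s Hs; apply HM; exists s; auto.
    - now apply Rmult_le_compat_l. }
  assert (E2 := I2 1 ltac:(lra)); rewrite along_1 in E2.
  intros X [s [Hs [-> | [-> | -> ] ]]].
  - specialize (I1 s Hs); lra.
  - specialize (I2 s Hs); lra.
  - replace (F (along P2 Q s)) with ((F (along P2 Q s) - F P2) + F P2) by ring.
    eapply Rle_trans; [apply Rabs_triang|].
    assert (Rabs (F (along P2 Q s) - F P2) <= M * Lam); [|lra].
    eapply Rle_trans; [eapply axis_seg_increment; eauto|].
    + intros s' Hs'; apply HM; exists s'; auto.
    + now apply Rmult_le_compat_l.
Qed.

(** A remainder of order [k + 1] vanishes at [B] and its partial derivatives are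
    remainders of order [k], so each order gains one factor [3 * Lam]. *)
Lemma remainder_path N F Lam B P1 P2 Q M k : jet Om N F -> path Lam B P1 P2 Q ->
  forall m n, (m + n + k <= N)%nat ->
  (forall m' n' X, (m' + n' = m + n + k)%nat -> on_path B P1 P2 Q X ->
     Rabs (F m' n' X) <= M) ->
  forall X, on_path B P1 P2 Q X -> Rabs (remainder F B k m n X) <= M * (3 * Lam) ^ k.
Proof.
  intros HF HP. induction k as [|k IH]; intros m n Hk HM X HX.
  - unfold remainder; cbn [taylor pow]. rewrite Rminus_0_r, Rmult_1_r.
    apply HM; auto; lia.
  - replace (M * (3 * Lam) ^ S k) with (M * (3 * Lam) ^ k * (3 * Lam)) by (simpl; ring).
    revert X HX. apply (path_bound _ (remainder F B k (S m) n) (remainder F B k m (S n))); auto.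
    + apply C1_minus; [apply HF; lia | apply C1_taylor].
    + unfold remainder. rewrite !Rminus_diag, taylor_at_0. ring.
    + intros X HX; split; apply IH; auto; try lia; intros; apply HM; auto; lia.
Qed.
End Remainder.

(** * Short paths near the boundary *)

(** The same [e] is the size of the neighbourhood and, as [1 / e], the constant in
    the length of the path; a single number is what the compactness argument needs. *)
Definition locally_joined (Om : R * R -> Prop) (B : R * R) : Prop :=
  exists e : posreal, forall P Q, supd B P < e -> supd B Q < e ->
    closure Om P -> closure Om Q -> joined Om (supd P Q / e) P Q.

Lemma joined_weaken (Om : R * R -> Prop) L L' P Q : L <= L' ->
  joined Om L P Q -> joined Om L' P Q.
Proof.
  intros H [P1 [P2 [S1 [S2 [S3 [L1 [L2 L3]]]]]]]. exists P1, P2.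
  unfold path. intuition lra.
Qed.

Section Graph.
Variables (Om : R * R -> Prop) (gam : R -> R) (x0 y0 e Lam : R).
Hypothesis e_pos : 0 < e.
Hypothesis Lam_pos : 0 <= Lam.
Hypothesis gam_lip : forall x x', Rabs (x - x0) < e -> Rabs (x' - x0) < e ->
  Rabs (gam x - gam x') <= Lam * Rabs (x - x').
Hypothesis above : forall Q, supd (x0, y0) Q < e -> (Om Q <-> gam (fst Q) < snd Q).

(** The strict inequality that defines the domain weakens to [<=] in the limit. *)
Lemma closure_above_graph P : supd (x0, y0) P < e -> closure Om P ->
  gam (fst P) <= snd P.
Proof.
  intros HP CP. apply Rnot_lt_le; intros H.
  set (eta := gam (fst P) - snd P).
  assert (Heta : 0 < eta) by (unfold eta; lra).
  set (r := Rmin (eta / (Lam + 1)) (e - supd (x0, y0) P)).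
  assert (Hr : 0 < r).
  { apply Rmin_glb_lt; [apply Rdiv_lt_0_compat|]; lra. }
  destruct (CP (mkposreal r Hr)) as [Q [OQ HQ]].
  apply supd_ball in HQ. simpl in HQ.
  assert (R1 : r <= eta / (Lam + 1)) by apply Rmin_l.
  assert (R2 : r <= e - supd (x0, y0) P) by apply Rmin_r.
  assert (BQ : supd (x0, y0) Q < e).
  { generalize (supd_triangle (x0, y0) P Q); lra. }
  apply above in OQ; [|exact BQ].
  assert (Hx := supd_fst (x0, y0) P). assert (Hx' := supd_fst (x0, y0) Q). simpl in Hx, Hx'.
  assert (G := gam_lip (fst P) (fst Q) ltac:(lra) ltac:(lra)).
  rewrite Rabs_minus_sym in G. rewrite (Rabs_minus_sym (fst P)) in G.
  assert (G1 := supd_fst P Q). assert (G2 := supd_snd P Q).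
  assert (Lam * Rabs (fst Q - fst P) <= Lam * r) by (apply Rmult_le_compat_l; lra).
  assert ((Lam + 1) * r <= eta).
  { apply Rle_trans with ((Lam + 1) * (eta / (Lam + 1))); [|right; field; lra].
    apply Rmult_le_compat_l; lra. }
  apply Rabs_le_between in G. assert (G2' : snd Q - snd P < r).
  { eapply Rle_lt_trans; [apply Rle_abs|]. lra. }
  unfold eta in *. lra.
Qed.

(** Both points are lifted to a common height above the graph between them;
    the Lipschitz constant [Lam] decides how much height is enough. *)
Lemma graph_locally_joined : locally_joined Om (x0, y0).
Proof.
  set (d := Rmin (e / (2 * Lam + 4)) (/ (Lam + 2))).
  assert (Hd : 0 < d).
  { apply Rmin_glb_lt; [apply Rdiv_lt_0_compat | apply Rinv_0_lt_compat]; lra. }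
  assert (D1 : (2 * Lam + 4) * d <= e).
  { apply Rle_trans with ((2 * Lam + 4) * (e / (2 * Lam + 4))); [|right; field; lra].
    apply Rmult_le_compat_l; [lra | apply Rmin_l]. }
  assert (D2 : Lam + 2 <= / d).
  { rewrite <- (Rinv_inv (Lam + 2)). apply Rinv_le_contravar; [exact Hd | apply Rmin_r]. }
  exists (mkposreal d Hd); simpl. intros P Q BP BQ CP CQ.
  assert (HdLam : 0 <= Lam * d) by (apply Rmult_le_pos; lra).
  assert (GP := closure_above_graph P ltac:(lra) CP).
  assert (GQ := closure_above_graph Q ltac:(lra) CQ).
  set (D := Rabs (fst Q - fst P)).
  assert (D0 : 0 <= D) by apply Rabs_pos.
  set (top := Rmax (snd P) (snd Q) + (Lam + 1) * D).
  assert (LD0 : 0 <= Lam * D) by (apply Rmult_le_pos; lra).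
  assert (TP : snd P <= top) by (unfold top; generalize (Rmax_l (snd P) (snd Q)); lra).
  assert (TQ : snd Q <= top) by (unfold top; generalize (Rmax_r (snd P) (snd Q)); lra).
  assert (Psup := supd_fst (x0, y0) P). assert (Psup' := supd_snd (x0, y0) P).
  assert (Qsup := supd_fst (x0, y0) Q). assert (Qsup' := supd_snd (x0, y0) Q).
  simpl in Psup, Psup', Qsup, Qsup'.
  assert (Dd : D <= 2 * d).
  { unfold D. replace (fst Q - fst P) with ((fst Q - x0) + - (fst P - x0)) by ring.
    eapply Rle_trans; [apply Rabs_triang|]. rewrite Rabs_Ropp. lra. }
  assert (LDd : Lam * D <= Lam * (2 * d)) by (apply Rmult_le_compat_l; lra).
  assert (Ttop : top < y0 + e).
  { apply Rabs_le_between in Psup', Qsup'. unfold top, Rmax; destruct Rle_dec; lra. }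
  assert (Box : forall x y, Rabs (x - x0) < d -> y0 - d < y < y0 + e -> supd (x0, y0) (x, y) < e).
  { intros x y Hx Hy. apply supd_ball, ball_plane; simpl. split; [lra|].
    apply Rabs_def1; lra. }
  assert (V : forall X, supd (x0, y0) X < d -> closure Om X -> snd X <= top ->
    axis_seg Om X (fst X, top) /\ axis_seg Om (fst X, top) X).
  { intros X BX CX HX.
    assert (GX := closure_above_graph X ltac:(lra) CX).
    assert (Xs := supd_fst (x0, y0) X). assert (Xs' := supd_snd (x0, y0) X).
    simpl in Xs, Xs'. apply Rabs_le_between in Xs'.
    assert (U : forall y, snd X < y <= top -> Om (fst X, y)).
    { intros y Hy. apply above; [apply Box|]; simpl; lra. }
    assert (CT : closure Om (fst X, top)).
    { destruct (Req_dec (snd X) top) as [<-|]; [now destruct X|].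
      apply domain_in_closure, U. lra. }
    assert (W : forall s, 0 < s < 1 -> X <> (fst X, top) ->
      snd X < snd X + s * (top - snd X) < top).
    { intros s Hs Ht.
      assert (Hlt : snd X < top).
      { destruct HX as [HX|HX]; [exact HX | contradict Ht]. rewrite <- HX; now destruct X. }
      generalize (Rmult_lt_0_compat s (top - snd X) ltac:(lra) ltac:(lra)); intros.
      assert (s * (top - snd X) < 1 * (top - snd X)) by (apply Rmult_lt_compat_r; lra). lra. }
    split; (split; [assumption | split; [assumption | split; [left; reflexivity|]]]);
      intros s NE Hs; unfold along; simpl.
    - rewrite Rminus_diag, Rmult_0_r, Rplus_0_r.
      apply U. specialize (W s Hs NE). lra.
    - rewrite Rminus_diag, Rmult_0_r, Rplus_0_r.
      apply U. specialize (W (1 - s) ltac:(lra) (not_eq_sym NE)). lra. }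
  destruct (V P BP CP TP) as [VP _]. destruct (V Q BQ CQ TQ) as [_ VQ].
  assert (PQ1 := supd_fst P Q). assert (PQ2 := supd_snd P Q).
  assert (Ttop2 : forall X, (X = P \/ X = Q) -> Rabs (top - snd X) <= (Lam + 2) * supd P Q).
  { intros X HX. assert ((Lam + 1) * D <= (Lam + 1) * supd P Q) by (apply Rmult_le_compat_l; unfold D; lra).
    apply Rabs_le_between in PQ2.
    destruct HX as [-> | ->]; (rewrite Rabs_pos_eq by lra);
      unfold top, Rmax; destruct Rle_dec; lra. }
  assert (LL : (Lam + 2) * supd P Q <= supd P Q / d).
  { unfold Rdiv. rewrite Rmult_comm. apply Rmult_le_compat_l; [apply supd_pos | exact D2]. }
  assert (SPQ : supd P Q <= (Lam + 2) * supd P Q).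
  { rewrite <- (Rmult_1_l (supd P Q)) at 1. apply Rmult_le_compat_r; [apply supd_pos | lra]. }
  exists (fst P, top), (fst Q, top).
  split; [exact VP|]. split; [|split; [exact VQ|]].
  - split; [apply VP|]. split; [apply VQ|]. split; [right; reflexivity|].
    intros s NE Hs. unfold along; simpl. rewrite Rminus_diag, Rmult_0_r, Rplus_0_r.
    assert (Dpos : 0 < D).
    { apply Rabs_pos_lt. intros E; apply NE. now replace (fst Q) with (fst P) by lra. }
    assert (Xs : Rabs (fst P + s * (fst Q - fst P) - x0) < d).
    { replace (fst P + s * (fst Q - fst P) - x0)
        with ((1 - s) * (fst P - x0) + s * (fst Q - x0)) by ring.
      eapply Rle_lt_trans; [apply Rabs_triang|]. rewrite !Rabs_mult, (Rabs_pos_eq (1 - s)), (Rabs_pos_eq s) by lra.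
      assert ((1 - s) * Rabs (fst P - x0) < (1 - s) * d) by (apply Rmult_lt_compat_l; lra).
      assert (s * Rabs (fst Q - x0) < s * d) by (apply Rmult_lt_compat_l; lra). lra. }
    apply Rabs_le_between in Psup'.
    apply above; simpl; [apply Box; lra|].
    assert (G := gam_lip (fst P + s * (fst Q - fst P)) (fst P) ltac:(lra) ltac:(lra)).
    replace (fst P + s * (fst Q - fst P) - fst P) with (s * (fst Q - fst P)) in G by ring.
    rewrite Rabs_mult, (Rabs_pos_eq s) in G by lra. fold D in G.
    assert (Lam * (s * D) <= Lam * (1 * D)).
    { apply Rmult_le_compat_l; [lra|]. apply Rmult_le_compat_r; lra. }
    apply Rabs_le_between in G.
    unfold top. generalize (Rmax_l (snd P) (snd Q)). lra.
  - repeat split; (eapply Rle_trans; [|exact LL]); apply supd_le; simpl;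
      rewrite ?Rminus_diag, ?Rabs_R0; try (generalize (supd_pos P Q); lra).
    + apply Ttop2; auto.
    + rewrite Rabs_minus_sym; apply Ttop2; auto.
Qed.
End Graph.

(** The four positions of a domain relative to its boundary graph differ by
    reflections of the plane. *)
Lemma locally_joined_isometry (Om : R * R -> Prop) (phi : R * R -> R * R) B :
  (forall P, phi (phi P) = P) ->
  (forall P Q, supd (phi P) (phi Q) = supd P Q) ->
  (forall P Q s, phi (along P Q s) = along (phi P) (phi Q) s) ->
  (forall P Q, fst P = fst Q \/ snd P = snd Q ->
     fst (phi P) = fst (phi Q) \/ snd (phi P) = snd (phi Q)) ->
  locally_joined (fun P => Om (phi P)) (phi B) -> locally_joined Om B.
Proof.
  intros Inv Iso Al Ax [e He]. exists e. intros P Q BP BQ CP CQ.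
  set (Om' := fun P => Om (phi P)).
  assert (C : forall X, closure Om X -> closure Om' (phi X)).
  { intros X HX r. destruct (HX r) as [Y [OY BY]]. exists (phi Y).
    unfold Om'. rewrite Inv, supd_ball, Iso, <- supd_ball. auto. }
  assert (C' : forall X, closure Om' X -> closure Om (phi X)).
  { intros X HX r. destruct (HX r) as [Y [OY BY]]. exists (phi Y).
    rewrite supd_ball, Iso, <- supd_ball. auto. }
  assert (S : forall X Y, axis_seg Om' X Y -> axis_seg Om (phi X) (phi Y)).
  { intros X Y [CX [CY [A H]]]. repeat split; auto.
    intros s NE Hs. rewrite <- Al. apply H; [congruence | exact Hs]. }
  destruct (He (phi P) (phi Q)) as [P1 [P2 [S1 [S2 [S3 [L1 [L2 L3]]]]]]]; rewrite ?Iso; auto.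
  exists (phi P1), (phi P2).
  apply S in S1, S2, S3. rewrite Inv in S1, S3.
  rewrite Iso in L1, L2, L3.
  rewrite <- Iso, Inv in L1. rewrite <- Iso in L2. rewrite <- Iso, Inv in L3.
  exact (conj S1 (conj S2 (conj S3 (conj L1 (conj L2 L3))))).
Qed.

Definition flip (P : R * R) : R * R := (fst P, - snd P).
Definition swap (P : R * R) : R * R := (snd P, fst P).

Lemma flip_joined (Om : R * R -> Prop) B :
  locally_joined (fun P => Om (flip P)) (flip B) -> locally_joined Om B.
Proof.
  apply locally_joined_isometry.
  - intros []; unfold flip; simpl; f_equal; ring.
  - intros P Q; unfold supd, flip; simpl. f_equal.
    rewrite <- Rabs_Ropp. f_equal; ring.
  - intros P Q s; unfold flip, along; simpl; f_equal; ring.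
  - intros P Q [H|H]; [left | right]; simpl; congruence.
Qed.

Lemma swap_joined (Om : R * R -> Prop) B :
  locally_joined (fun P => Om (swap P)) (swap B) -> locally_joined Om B.
Proof.
  apply locally_joined_isometry.
  - now intros [].
  - intros P Q; apply Rmax_comm.
  - reflexivity.
  - intros P Q [H|H]; [right | left]; exact H.
Qed.

Definition lipschitz_at (gam : R -> R) (x0 : R) : Prop :=
  exists e Lam, 0 < e /\ 0 <= Lam /\
    forall x x', Rabs (x - x0) < e -> Rabs (x' - x0) < e ->
      Rabs (gam x - gam x') <= Lam * Rabs (x - x').

Lemma C1_lipschitz (gam : R -> R) x0 : (forall s, ex_derive gam s) ->
  continuous (Derive gam) x0 -> lipschitz_at gam x0.
Proof.
  intros HD HC.
  destruct (HC (ball (Derive gam x0) 1)) as [e He].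
  { now exists (mkposreal 1 Rlt_0_1). }
  exists e, (Rabs (Derive gam x0) + 1).
  split; [apply e|]. split; [generalize (Rabs_pos (Derive gam x0)); lra|].
  intros x x' Hx Hx'.
  destruct (MVT_gen gam x' x (Derive gam)) as [c [Hc ->]].
  - intros s _; now apply Derive_correct.
  - intros s _; apply continuity_pt_filterlim.
    apply (ex_derive_continuous gam s (HD s)).
  - rewrite Rabs_mult. apply Rmult_le_compat_r; [apply Rabs_pos|].
    assert (Bc : Rabs (c - x0) < e).
    { apply Rabs_def2 in Hx, Hx'. apply Rabs_def1;
        revert Hc; unfold Rmin, Rmax; repeat destruct Rle_dec; lra. }
    specialize (He c Bc). change (Rabs (Derive gam c - Derive gam x0) < 1) in He.
    replace (Derive gam c) with (Derive gam x0 + (Derive gam c - Derive gam x0)) by ring.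
    eapply Rle_trans; [apply Rabs_triang|]. lra.
Qed.

Lemma above_joined (Om : R * R -> Prop) gam B : lipschitz_at gam (fst B) ->
  locally B (fun Q => Om Q <-> gam (fst Q) < snd Q) -> locally_joined Om B.
Proof.
  intros [e1 [Lam [He1 [HL Lip]]]] [e2 He2].
  destruct B as [x0 y0]; simpl in *.
  apply (graph_locally_joined Om gam x0 y0 (Rmin e1 e2) Lam).
  - apply Rmin_glb_lt; [exact He1 | apply e2].
  - exact HL.
  - intros x x' Hx Hx'. apply Lip; eapply Rlt_le_trans; eauto; apply Rmin_l.
  - intros Q HQ. apply He2, supd_ball. eapply Rlt_le_trans; [exact HQ | apply Rmin_r].
Qed.

Lemma below_joined (Om : R * R -> Prop) gam B : lipschitz_at gam (fst B) ->
  locally B (fun Q => Om Q <-> snd Q < gam (fst Q)) -> locally_joined Om B.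
Proof.
  intros [e1 [Lam [He1 [HL Lip]]]] [e2 He2].
  apply flip_joined, (above_joined _ (fun x => - gam x)).
  - exists e1, Lam; repeat split; auto. intros x x' Hx Hx'.
    replace (- gam x - - gam x') with (- (gam x - gam x')) by ring.
    rewrite Rabs_Ropp; auto.
  - exists e2. intros Q HQ. rewrite (He2 (flip Q)); [simpl; split; lra|].
    apply ball_plane in HQ; apply ball_plane; simpl in *. destruct HQ as [H1 H2].
    split; [exact H1|]. rewrite <- Rabs_Ropp. replace (- (- snd Q - snd B)) with (snd Q - - snd B) by ring.
    exact H2.
Qed.

Lemma boundary_joined (Om : R * R -> Prop) k B : (1 <= k)%nat -> Ck_boundary k Om ->
  boundary Om B -> locally_joined Om B.
Proof.
  intros Hk HC HB. destruct (HC B HB) as [gam [Hg Hloc]].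
  assert (Lip : forall x, lipschitz_at gam x).
  { intros x; apply C1_lipschitz.
    - intros s. now apply (Hg 1%nat s).
    - now apply (Hg 1%nat x). }
  assert (Sw : forall Pr : R * R -> Prop, locally B Pr -> locally (swap B) (fun Q => Pr (swap Q))).
  { intros Pr [e He]. exists e. intros Q HQ. apply He.
    apply ball_plane in HQ; apply ball_plane.
    destruct HQ; split; assumption. }
  destruct Hloc as [H|[H|[H|H]]].
  - now apply (above_joined Om gam).
  - now apply (below_joined Om gam).
  - apply swap_joined, (above_joined _ gam); auto. exact (Sw _ H).
  - apply swap_joined, (below_joined _ gam); auto. exact (Sw _ H).
Qed.

(** * Uniform Taylor estimates at the boundary *)

(** A Lebesgue number for the cover by the neighbourhoods on which [Pr] holds;
    monotonicity replaces the local value of [e] by that number. *)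
Lemma uniform_on_box (Pr : R * R -> R -> Prop) :
  (forall P e d, 0 < d <= e -> Pr P e -> Pr P d) ->
  (forall C : R * R, exists e : posreal, forall P, supd C P < e -> Pr P e) ->
  forall rho, exists d : posreal,
    forall P, Rabs (fst P) <= rho -> Rabs (snd P) <= rho -> Pr P d.
Proof.
  intros Mon Loc rho.
  set (delta := fun x y => proj1_sig (constructive_indefinite_description _ (Loc (x, y)))).
  assert (Hdelta : forall x y P, supd (x, y) P < delta x y -> Pr P (delta x y)).
  { intros x y. unfold delta. now destruct constructive_indefinite_description. }
  destruct (compactness_value_2d (- rho) rho (- rho) rho delta) as [d Hd].
  exists d. intros [x y] Hx Hy. simpl in *.
  apply Rabs_le_between in Hx, Hy.
  apply NNPP. intros HN. apply (Hd x y Hx Hy). intros [u [v [_ [_ [H1 [H2 H3]]]]]].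
  apply HN, (Mon _ (delta u v)); [split; [apply d | exact H3]|].
  apply Hdelta. apply supd_ball, ball_plane; auto.
Qed.

Lemma not_closure_nearby (Om : R * R -> Prop) C : ~ closure Om C ->
  exists e : posreal, forall P, supd C P < e -> ~ closure Om P.
Proof.
  intros H. apply not_all_ex_not in H. destruct H as [e He].
  exists (pos_div_2 e). intros P HP CP. apply He.
  destruct (CP (pos_div_2 e)) as [Q [OQ HQ]]. exists Q; split; [exact OQ|].
  apply supd_ball. apply supd_ball in HQ. simpl in *.
  generalize (supd_triangle C P Q); lra.
Qed.

(** The bound is sought in the form [1 / e], which [uniform_on_box] can make uniform. *)
Lemma cont_bounded_on_box (Om : R * R -> Prop) F : cont_on_closure Om F ->
  forall rho, exists M, forall P, closure Om P ->
    Rabs (fst P) <= rho -> Rabs (snd P) <= rho -> Rabs (F P) <= M.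
Proof.
  intros HF rho.
  destruct (uniform_on_box (fun P e => closure Om P -> Rabs (F P) <= / e)) with (rho := rho)
    as [d Hd].
  - intros P e d Hd H HP. eapply Rle_trans; [now apply H|]. apply Rinv_le_contravar; apply Hd.
  - intros C. destruct (excluded_middle_informative (closure Om C)) as [HC|HC].
    + destruct (HF C HC (ball (F C) 1)) as [e He].
      { now exists (mkposreal 1 Rlt_0_1). }
      set (K := Rabs (F C) + 1). assert (HK : 0 < K) by (unfold K; generalize (Rabs_pos (F C)); lra).
      assert (Hr : 0 < Rmin e (/ K)) by (apply Rmin_glb_lt; [apply e | now apply Rinv_0_lt_compat]).
      exists (mkposreal _ Hr). simpl. intros P HP CP.
      apply Rle_trans with K.
      * assert (H : ball (F C) 1 (F P)).
        { apply He; [|exact CP]. apply supd_ball. eapply Rlt_le_trans; [exact HP | apply Rmin_l]. }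
        change (Rabs (F P - F C) < 1) in H.
        replace (F P) with (F C + (F P - F C)) by ring.
        eapply Rle_trans; [apply Rabs_triang|]. unfold K; lra.
      * rewrite <- (Rinv_inv K) at 1. apply Rinv_le_contravar; [exact Hr | apply Rmin_r].
    + destruct (not_closure_nearby Om C HC) as [e He].
      exists e. intros P HP CP. exfalso. now apply (He P).
  - exists (/ d). auto.
Qed.

Lemma common_bound (Pr : nat -> R -> Prop) (N : nat) :
  (forall m M M', M <= M' -> Pr m M -> Pr m M') ->
  (forall m, (m < N)%nat -> exists M, Pr m M) ->
  exists M, forall m, (m < N)%nat -> Pr m M.
Proof.
  intros Mon H. induction N as [|N IH]; [exists 0; intros; lia|].
  destruct IH as [M1 H1]; [intros; apply H; lia|].
  destruct (H N ltac:(lia)) as [M2 H2].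
  exists (Rmax M1 M2). intros m Hm.
  destruct (Nat.eq_dec m N) as [->|Hn].
  - eapply Mon; [apply Rmax_r | exact H2].
  - eapply Mon; [apply Rmax_l | apply H1; lia].
Qed.

Lemma jet_cont (Om : R * R -> Prop) N F m n : (1 <= N)%nat -> jet Om N F ->
  (m + n <= N)%nat -> cont_on_closure Om (F m n).
Proof.
  intros HN HF Hmn.
  destruct (le_lt_dec N (m + n)) as [H|H]; [|now apply HF].
  destruct m as [|m].
  - destruct n as [|n]; [lia|]. apply (HF 0%nat n); lia.
  - apply (HF m n); lia.
Qed.

Lemma jet_bounded_on_box (Om : R * R -> Prop) N F : (1 <= N)%nat -> jet Om N F ->
  forall rho, exists M, forall m n P, (m + n <= N)%nat -> closure Om P ->
    Rabs (fst P) <= rho -> Rabs (snd P) <= rho -> Rabs (F m n P) <= M.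
Proof.
  intros HN HF rho.
  destruct (common_bound (fun m M => forall n P, (m + n <= N)%nat -> closure Om P ->
    Rabs (fst P) <= rho -> Rabs (snd P) <= rho -> Rabs (F m n P) <= M) (S N)) as [M HM].
  - intros m M M' HMM H n P; intros; eapply Rle_trans; [now apply H | exact HMM].
  - intros m Hm.
    destruct (common_bound (fun n M => forall P, (m + n <= N)%nat -> closure Om P ->
      Rabs (fst P) <= rho -> Rabs (snd P) <= rho -> Rabs (F m n P) <= M) (S N)) as [M HM].
    + intros n M M' HMM H P; intros; eapply Rle_trans; [now apply H | exact HMM].
    + intros n Hn. destruct (le_lt_dec (m + n) N) as [H|H]; [|exists 0; intros; lia].
      destruct (cont_bounded_on_box Om _ (jet_cont Om N F m n HN HF H) rho) as [M HM].
      exists M; auto.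
    + exists M. intros n P Hn. apply HM; lia.
  - exists M. intros m n P Hn. apply HM; lia.
Qed.

Section Uniform.
Variables (Om : R * R -> Prop) (N : nat) (F : nat -> nat -> R * R -> R).
Hypothesis OmO : open Om.
Hypothesis Om_joined : forall B, boundary Om B -> locally_joined Om B.
Hypothesis N_pos : (1 <= N)%nat.
Hypothesis jetF : jet Om N F.

Lemma uniformly_joined rho : exists e : posreal, forall B,
  Rabs (fst B) <= rho -> Rabs (snd B) <= rho -> boundary Om B ->
  forall X, closure Om X -> supd B X < e -> joined Om (supd B X / e) B X.
Proof.
  destruct (uniform_on_box (fun B e => boundary Om B ->
    forall X, closure Om X -> supd B X < e -> joined Om (supd B X / e) B X))
    with (rho := rho) as [d Hd].
  - intros B e d Hd H HB X CX BX.
    apply (joined_weaken Om (supd B X / e)); [|apply H; auto; lra].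
    apply Rmult_le_compat_l; [apply supd_pos|]. apply Rinv_le_contravar; lra.
  - intros C. destruct (excluded_middle_informative (boundary Om C)) as [HC|HC].
    + destruct (Om_joined C HC) as [e He].
      exists (pos_div_2 e). simpl. intros B HB [BB _] X CX BX.
      generalize (supd_triangle C B X) (cond_pos e); intros.
      apply (joined_weaken Om (supd B X / e)); [|apply He; auto; lra].
      apply Rmult_le_compat_l; [apply supd_pos|]. apply Rinv_le_contravar; lra.
    + apply not_and_or in HC.
      destruct HC as [HC|HC]; destruct (not_closure_nearby _ C HC) as [e He]; exists e;
        intros B HB [B1 B2]; exfalso; now apply (He B HB).
  - exists d. intros B H1 H2. now apply Hd.
Qed.

(** The path from [B] to [X] has length at most [3 / e] times their distance and
    stays in a larger box, where the derivatives of order at most [N] are bounded. *)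
Lemma uniform_taylor rho : exists (e : posreal) (K : R), 0 <= K /\
  forall B X k m n, Rabs (fst B) <= rho -> Rabs (snd B) <= rho ->
    boundary Om B -> closure Om X -> supd B X < e -> (m + n + k <= N)%nat ->
    Rabs (remainder F B k m n X) <= K * supd B X ^ k.
Proof.
  destruct (uniformly_joined rho) as [e He].
  (* [3] because each of the three segments is no longer than [supd B X / e <= 1] *)
  destruct (jet_bounded_on_box Om N F N_pos jetF (rho + 3)) as [M0 HM].
  set (M := Rmax M0 0). assert (HM0 : 0 <= M) by apply Rmax_r.
  set (c := Rmax 1 (3 / e)).
  exists e, (M * c ^ N). assert (Hc : 1 <= c) by apply Rmax_l.
  split; [apply Rmult_le_pos; [exact HM0 | apply pow_le; lra]|].
  intros B X k m n B1 B2 HB CX BX Hk.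
  destruct (He B B1 B2 HB X CX BX) as [P1 [P2 HP]].
  set (L := supd B X / e) in *.
  assert (HL : 0 <= L <= 1).
  { unfold L. split; [apply Rdiv_le_0_compat; [apply supd_pos | apply e]|].
    apply (Rdiv_le_1 (supd B X) e (cond_pos e)). lra. }
  apply Rle_trans with (M * (3 * L) ^ k).
  - apply (remainder_path Om OmO N F L B P1 P2 X); auto.
    + intros m' n' Y Hmn HY.
      assert (BY := on_path_supd Om L B P1 P2 X Y HP HY).
      eapply Rle_trans; [|apply Rmax_l].
      apply HM; [lia | eapply on_path_closure; eauto | |].
      * replace (fst Y) with (fst B + (fst Y - fst B)) by ring.
        eapply Rle_trans; [apply Rabs_triang|]. generalize (supd_fst B Y); lra.
      * replace (snd Y) with (snd B + (snd Y - snd B)) by ring.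
        eapply Rle_trans; [apply Rabs_triang|]. generalize (supd_snd B Y); lra.
    + exists 1. split; [lra|]. right; right; symmetry; apply along_1.
  - rewrite Rmult_assoc. apply Rmult_le_compat_l; [exact HM0|].
    apply Rle_trans with (c ^ k * supd B X ^ k).
    + rewrite <- Rpow_mult_distr. apply pow_incr. split; [lra|].
      replace (3 * L) with (3 / e * supd B X) by (unfold L; field; apply Rgt_not_eq, e).
      apply Rmult_le_compat_r; [apply supd_pos | apply Rmax_r].
    + apply Rmult_le_compat_r; [apply pow_le, supd_pos|]. apply Rle_pow; [exact Hc | lia].
Qed.
End Uniform.

(** * Differentiating along the boundary curve *)

Lemma derive_lipschitz (f : R -> R) t l : is_derive f t l ->
  locally t (fun s : R => Rabs (f s - f t) <= (Rabs l + 1) * Rabs (s - t)).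
Proof.
  intros H. apply is_derive_Reals in H. destruct (H 1 Rlt_0_1) as [d Hd].
  cut (forall s : R, Rabs (s - t) < d -> Rabs (f s - f t) <= (Rabs l + 1) * Rabs (s - t)).
  { intros C; exists d; exact C. }
  intros s Hs.
  destruct (Req_dec s t) as [->|Hst].
  - rewrite !Rminus_diag, Rabs_R0. lra.
  - specialize (Hd (s - t) ltac:(lra) Hs).
    replace (t + (s - t)) with s in Hd by ring.
    replace (f s - f t) with ((l + ((f s - f t) / (s - t) - l)) * (s - t)) by (field; lra).
    rewrite Rabs_mult. apply Rmult_le_compat_r; [apply Rabs_pos|].
    eapply Rle_trans; [apply Rabs_triang|]. lra.
Qed.

Lemma derive_quadratic (f : R -> R) t K :
  locally t (fun s : R => Rabs (f s) <= K * Rabs (s - t) ^ 2) -> is_derive f t 0.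
Proof.
  intros H.
  assert (H0 : f t = 0).
  { apply locally_singleton in H. rewrite Rminus_diag, Rabs_R0 in H.
    apply Rabs_eq_0. generalize (Rabs_pos (f t)). simpl in H. lra. }
  apply is_derive_Reals. intros eps Heps. destruct H as [d Hd].
  assert (HK : 0 < Rabs K + 1) by (generalize (Rabs_pos K); lra).
  assert (Hr : 0 < Rmin d (eps / (Rabs K + 1)))
    by (apply Rmin_glb_lt; [apply d | now apply Rdiv_lt_0_compat]).
  exists (mkposreal _ Hr). simpl. intros h Hh Hlt.
  assert (L1 := Rmin_l d (eps / (Rabs K + 1))). assert (L2 := Rmin_r d (eps / (Rabs K + 1))).
  specialize (Hd (t + h)). replace (t + h - t) with h in Hd by ring.
  assert (B : Rabs (f (t + h)) <= K * Rabs h ^ 2).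
  { apply Hd. change (Rabs (t + h - t) < d). replace (t + h - t) with h by ring. lra. }
  rewrite H0, !Rminus_0_r. unfold Rdiv. rewrite Rabs_mult, Rabs_inv.
  assert (Hp := Rabs_pos_lt h Hh).
  apply Rle_lt_trans with ((Rabs K + 1) * Rabs h).
  - apply (Rmult_le_reg_r (Rabs h) _ _ Hp). rewrite Rmult_assoc, Rinv_l, Rmult_1_r by lra.
    eapply Rle_trans; [exact B|]. simpl. rewrite Rmult_1_r, Rmult_assoc.
    apply Rmult_le_compat_r; [now apply Rmult_le_pos; lra|]. generalize (Rle_abs K); lra.
  - replace eps with ((Rabs K + 1) * (eps / (Rabs K + 1))) by (field; lra).
    apply Rmult_lt_compat_l; lra.
Qed.

Section Chain.
Variables (Om : R * R -> Prop) (N : nat) (F : nat -> nat -> R * R -> R).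
Variables (T : R -> Prop) (p q : R -> R).
Hypothesis OmO : open Om.
Hypothesis Om_joined : forall B, boundary Om B -> locally_joined Om B.
Hypothesis jetF : jet Om N F.
Hypothesis T_open : open T.
Hypothesis on_boundary : forall t, T t -> boundary Om (p t, q t).

(** The first-order Taylor polynomial at the point of parameter [t] has the expected
    derivative along the curve; the remainder is quadratic in [s - t], because the
    curve is Lipschitz at [t]. *)
Lemma boundary_chain_rule m n t dp dq : (m + n + 2 <= N)%nat -> T t ->
  is_derive p t dp -> is_derive q t dq ->
  is_derive (fun s => F m n (p s, q s)) t
    (F (S m) n (p t, q t) * dp + F m (S n) (p t, q t) * dq).
Proof.
  intros Hmn Ht Dp Dq.
  set (B := (p t, q t)).
  destruct (uniform_taylor Om N F OmO Om_joined ltac:(lia) jetF (Rmax (Rabs (p t)) (Rabs (q t))))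
    as [e [K [K0 HK]]].
  assert (DR : is_derive (fun s => remainder F B 2 m n (p s, q s)) t 0).
  { set (L := Rabs dp + Rabs dq + 1).
    apply (derive_quadratic _ _ (K * L ^ 2)).
    assert (C : forall f l, is_derive f t l -> locally t (fun s : R => Rabs (f s - f t) < e)).
    { intros f l Hf. apply (ex_derive_continuous f t (ex_intro _ l Hf) (ball (f t) e)).
      now exists e. }
    generalize (filter_and _ _ (filter_and _ _ (C p dp Dp) (C q dq Dq)) (filter_and _ _ (T_open t Ht)
      (filter_and _ _ (derive_lipschitz p t dp Dp) (derive_lipschitz q t dq Dq)))).
    apply filter_imp. intros s [[C1 C2] [Ts [L1 L2]]].
    assert (BB : supd B (p s, q s) <= L * Rabs (s - t)).
    { generalize (Rabs_pos dp) (Rabs_pos dq); intros.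
      apply supd_le; simpl; (eapply Rle_trans; [eassumption|]);
        apply Rmult_le_compat_r; auto using Rabs_pos; unfold L; lra. }
    eapply Rle_trans; [apply HK|]; simpl; auto using Rmax_l, Rmax_r.
    - now apply on_boundary.
    - now apply (proj1 (on_boundary s Ts)).
    - now apply supd_ball, ball_plane.
    - rewrite Rmult_assoc. apply Rmult_le_compat_l; [exact K0|].
      rewrite !Rmult_1_r. replace (L * L * (Rabs (s - t) * Rabs (s - t)))
        with ((L * Rabs (s - t)) * (L * Rabs (s - t))) by ring.
      apply Rmult_le_compat; auto using supd_pos. }
  apply (is_derive_ext (fun s => (F m n B + (p s - p t) * F (S m) n B + (q s - q t) * F m (S n) B)
     + remainder F B 2 m n (p s, q s))).
  { intros s. unfold remainder; cbn. unfold B; simpl. field. }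
  replace (F (S m) n B * dp + F m (S n) B * dq)
    with ((F (S m) n B * dp + F m (S n) B * dq) + 0) by ring.
  apply @is_derive_plus; [|exact DR].
  auto_derive; [repeat split; eexists; eassumption|].
  rewrite (is_derive_unique (fun x : R => p x) t dp Dp), (is_derive_unique (fun x : R => q x) t dq Dq). ring.
Qed.
End Chain.

(** * Elimination of derivatives at a boundary point *)
Definition A_row {J : bdata} (mu tau : R) (c : nat -> R) (k : nat) : R :=
  coeff_mat 0 (Mmult (A_mat mu tau) (mk_matrix 4 1 (fun sigma _ => c sigma))) k 0.

(** The summand of [scheme_rhs], freed from the grid. *)
Definition point_rhs {J : bdata} (mu tau : R) (c : nat -> R) (h : R) : R :=
  let c0 := c 0%nat in
  let c1 := c 1%nat in
  let c2 := c 2%nat in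
  let c3 := c 3%nat in
  g0*c0
  + (c0*g1*mu*omega8 + c1*g0)*h
  + (g0*c2 + g1*omega8*mu*c1
     + ((eta4*f00 + g0*omega4 + g1*omega10 + g2*omega15)*mu^2
        + tau^2*(eta1*f00 + g0*omega1 + g1*omega6 + g2*omega12))*c0)*h^2
  + (((eta5*f00 + eta7*f01 + eta9*f10
       + g0*omega5 + g1*omega11 + g2*omega16 + g3*omega18)*mu^3
      + tau^2*(eta3*f00 + eta6*f01 + eta8*f10
               + g0*omega3 + g1*omega9 + g2*omega14 + g3*omega17)*mu
      + tau^3*(g0*omega2 + g1*omega7 + g2*omega13 + f00*eta2 + f01/6))*c0
     + c1*(eta4*f00 + g0*omega4 + g1*omega10 + g2*omega15)*mu^2
     + g1*omega8*mu*c2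
     + c1*(eta1*f00 + g0*omega1 + g1*omega6 + g2*omega12)*tau^2
     + g0*c3)*h^3.

Section Elimination.
Context {J : bdata}.
Variables ux uy uxx uxy uyy uxxx uxxy uxyy uyyy : R.
Hypothesis p1_neq0 : p1 <> 0.
Hypothesis D2_neq0 : D2 <> 0.
Hypothesis D3_neq0 : D3 <> 0.
Hypothesis bc1 : g1 = ux*p1 + uy*q1.
Hypothesis bc2 : g2 = (uxx*p1 + uxy*q1)*p1 + ux*p2 + ((uxy*p1 + uyy*q1)*q1 + uy*q2).
Hypothesis bc3 : g3 =
  ((uxxx*p1 + uxxy*q1)*p1 + uxx*p2 + ((uxxy*p1 + uxyy*q1)*q1 + uxy*q2))*p1
  + (uxx*p1 + uxy*q1)*p2 + ((uxx*p1 + uxy*q1)*p2 + ux*p3)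
  + (((uxxy*p1 + uxyy*q1)*p1 + uxy*p2 + ((uxyy*p1 + uyyy*q1)*q1 + uyy*q2))*q1
  + (uxy*p1 + uyy*q1)*q2 + ((uxy*p1 + uyy*q1)*q2 + uy*q3)).
Hypothesis pde : uxx + uyy + a00*ux + b00*uy + d00*g0 - f00 = 0.
Hypothesis pde_x : uxxx + uxyy + (a10*ux + a00*uxx) + (b10*uy + b00*uxy)
  + (d10*g0 + d00*ux) - f10 = 0.
Hypothesis pde_y : uxxy + uyyy + (a01*ux + a00*uxy) + (b01*uy + b00*uyy)
  + (d01*g0 + d00*uy) - f01 = 0.

Lemma D4_factor : D4 = D2 * D3.
Proof. unfold D4, D2, D3; ring. Qed.

Lemma elim_ux : ux = s1*uy + omega8*g1.
Proof. unfold s1, omega8, z1. rewrite bc1. field. exact p1_neq0. Qed.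

Lemma elim_uyy : uyy = f00 - uxx - a00*ux - b00*uy - d00*g0.
Proof. lra. Qed.

(** After [uyy] is removed by the equation, [uxx] has the coefficient
    [p1^2 - q1^2 = D2] in the second derivative of the boundary condition. *)
Lemma elim_uxx : uxx = s3*uxy + s2*uy - z3*f00 - z2*g0 - z4*g1 - z5*g2.
Proof.
  apply (Rmult_eq_reg_r (p1 * D2)); [|now apply Rmult_integral_contrapositive].
  unfold s3, s2, z3, z2, z4, z5. 
  transitivity (p1 * (g2 - 2*uxy*p1*q1 - q1^2*(f00 - a00*ux - b00*uy - d00*g0) - ux*p2 - uy*q2)).
  - rewrite bc2, elim_uyy. unfold D2. ring.
  - rewrite elim_ux. unfold s1, omega8, z1. field. now split.
Qed.

Lemma elim_uyyy : uyyy = f01 - uxxy - (a01*ux + a00*uxy) - (b01*uy + b00*uyy) - (d01*g0 + d00*uy).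
Proof. lra. Qed.

Lemma elim_uxyy : uxyy = f10 - uxxx - (a10*ux + a00*uxx) - (b10*uy + b00*uxy) - (d10*g0 + d00*ux).
Proof. lra. Qed.

(** After [uxyy] and [uyyy] are removed by the differentiated equation, [uxxx] has
    the coefficient [p1^3 - 3 p1 q1^2 = p1 D3] in the third derivative of the
    boundary condition. *)
Lemma elim_uxxx : uxxx = s6*uxxy + s5*uxy + s4*uy - z7*f00 - z8*f01 - z10*f10
  - z6*g0 - z9*g1 - z11*g2 - z12*g3.
Proof.
  assert (D4_neq0 : D4 <> 0)
    by (rewrite D4_factor; now apply Rmult_integral_contrapositive).
  assert (E : uxxx * (p1 * D3) = g3
    - 3*uxxy*p1^2*q1
    - 3*p1*q1^2*(f10 - (a10*ux + a00*uxx) - (b10*uy + b00*uxy) - (d10*g0 + d00*ux))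
    - q1^3*(f01 - uxxy - (a01*ux + a00*uxy) - (b01*uy + b00*uyy) - (d01*g0 + d00*uy))
    - 3*(uxx*p1*p2 + uxy*(p1*q2 + p2*q1) + uyy*q1*q2) - ux*p3 - uy*q3).
  { rewrite bc3, elim_uyyy, elim_uxyy. unfold D3. ring. }
  apply (Rmult_eq_reg_r (p1 * D3)); [|now apply Rmult_integral_contrapositive].
  rewrite E, elim_uyy, elim_uxx, elim_ux.
  unfold s6, s5, s4, s3, s2, s1, z7, z8, z10, z6, z9, z11, z12, z3, z2, z4, z5, omega8, z1.
  revert D2_neq0 D3_neq0 D4_neq0. unfold D4, D3, D2. intros.
  field. auto.
Qed.

Variables (mu tau : R) (c : nat -> R).

Let c0 := c 0%nat.
Let c1 := c 1%nat.
Let c2 := c 2%nat.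
Let c3 := c 3%nat.

Let T1 := mu*ux + tau*uy.
Let T2 := (mu^2*uxx + 2*mu*tau*uxy + tau^2*uyy)/2.
Let T3 := (mu^3*uxxx + 3*mu^2*tau*uxxy + 3*mu*tau^2*uxyy + tau^3*uyyy)/6.

Let row := A_row mu tau c.

(** At each order in [h] the elimination splits [C u] into data, which the scheme
    collects on its right-hand side, and multiples of the free derivatives [uy],
    [uxy], [uxxy], whose factors are the rows of the linear system. *)
Lemma expansion_order1 :
  c0*T1 + c1*g0 = (c0*g1*mu*omega8 + c1*g0) + uy * row 0.
Proof.
  replace (row 0) with ((mu*xi3 + tau) * c0) by (unfold row, A_row, c0, c1, c2; cbn; ring).
  unfold T1. rewrite elim_ux. unfold xi3. ring.
Qed.

Lemma expansion_order2 :
  c0*T2 + c1*T1 + c2*g0 =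
  (g0*c2 + g1*omega8*mu*c1
       + ((eta4*f00 + g0*omega4 + g1*omega10 + g2*omega15)*mu^2
          + tau^2*(eta1*f00 + g0*omega1 + g1*omega6 + g2*omega12))*c0)
  + uxy * row 1 + uy * row 3.
Proof.
  replace (row 1) with ((mu^2*xi10 + tau^2*xi7 + mu*tau) * c0)
    by (unfold row, A_row, c0, c1, c2; cbn; ring).
  replace (row 3) with ((mu^2*xi5 + tau^2*xi1) * c0 + (mu*xi3 + tau) * c1)
    by (unfold row, A_row, c0, c1, c2; cbn; ring).
  unfold T1, T2. rewrite elim_uyy, elim_uxx, elim_ux.
  unfold xi10, xi7, xi5, xi1, xi3, eta4, omega4, omega10, omega15, eta1, omega1, omega6, omega12.
  unfold omega8. field.
Qed.

Lemma expansion_order3 :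
  c0*T3 + c1*T2 + c2*T1 + c3*g0 =
  (((eta5*f00 + eta7*f01 + eta9*f10
         + g0*omega5 + g1*omega11 + g2*omega16 + g3*omega18)*mu^3
        + tau^2*(eta3*f00 + eta6*f01 + eta8*f10
                 + g0*omega3 + g1*omega9 + g2*omega14 + g3*omega17)*mu
        + tau^3*(g0*omega2 + g1*omega7 + g2*omega13 + f00*eta2 + f01/6))*c0
       + c1*(eta4*f00 + g0*omega4 + g1*omega10 + g2*omega15)*mu^2
       + g1*omega8*mu*c2
       + c1*(eta1*f00 + g0*omega1 + g1*omega6 + g2*omega12)*tau^2
       + g0*c3)
  + uxxy * row 2 + uxy * row 4 + uy * row 5.
Proof.
  replace (row 2) with ((mu*xi12*tau^2 - tau^3/6 + mu^2*tau/2 + mu^3*xi13) * c0)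
    by (unfold row, A_row, c0, c1, c2; cbn; ring).
  replace (row 4) with ((mu^3*xi11 + mu*tau^2*xi9 + tau^3*xi8) * c0
      + (mu^2*xi10 + tau^2*xi7 + mu*tau) * c1) by (unfold row, A_row, c0, c1, c2; cbn; ring).
  replace (row 5) with ((mu^3*xi6 + mu*tau^2*xi4 + tau^3*xi2) * c0
      + (mu^2*xi5 + tau^2*xi1) * c1 + (mu*xi3 + tau) * c2) by (unfold row, A_row, c0, c1, c2; cbn; ring).
  unfold T1, T2, T3. rewrite elim_uyyy, elim_uxyy, elim_uxxx, elim_uyy, elim_uxx, elim_ux.
  unfold xi12, xi13, xi11, xi9, xi8, xi10, xi7, xi6, xi4, xi2, xi5, xi1, xi3.
  unfold eta5, eta7, eta9, eta3, eta6, eta8, eta2, eta4, eta1.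
  unfold omega1, omega2, omega3, omega4, omega5, omega6, omega7, omega9, omega10,
    omega11, omega12, omega13, omega14, omega15, omega16, omega17, omega18, omega8.
  field.
Qed.

Lemma expansion h :
  c0*g0 + (c0*T1 + c1*g0)*h + (c0*T2 + c1*T1 + c2*g0)*h^2
  + (c0*T3 + c1*T2 + c2*T1 + c3*g0)*h^3
  = point_rhs mu tau c h
    + (uy*h * row 0 + (uxy*h^2 * row 1 + (uy*h^2 * row 3
    + (uxxy*h^3 * row 2 + (uxy*h^3 * row 4 + uy*h^3 * row 5))))).
Proof.
  rewrite expansion_order1, expansion_order2, expansion_order3.
  unfold point_rhs; cbv zeta; fold c0 c1 c2 c3. ring.
Qed.
End Elimination.

(** * Sums over the stencil *)
Section Stencil.
Variables (Om : R * R -> Prop) (N : nat) (i j : Z).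

Lemma sumS_ext (F G : Z -> Z -> R) :
  (forall r l, (-1 <= r <= 1)%Z -> (-1 <= l <= 1)%Z ->
     closure Om (grid N (i + r) (j + l)) -> F r l = G r l) ->
  sumS Om N i j F = sumS Om N i j G.
Proof.
  intros H. unfold sumS, sum3.
  assert (K : forall r l, (-1 <= r <= 1)%Z -> (-1 <= l <= 1)%Z ->
    (if excluded_middle_informative (closure Om (grid N (i + r) (j + l))) then F r l else 0)
    = (if excluded_middle_informative (closure Om (grid N (i + r) (j + l))) then G r l else 0)).
  { intros r l Hr Hl. destruct excluded_middle_informative; auto. }
  rewrite !K by lia. reflexivity.
Qed.

Lemma sumS_plus (F G : Z -> Z -> R) :
  sumS Om N i j (fun r l => F r l + G r l) = sumS Om N i j F + sumS Om N i j G.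
Proof.
  unfold sumS, sum3.
  assert (K : forall r l (b : {closure Om (grid N (i + r) (j + l))}
                              + {~ closure Om (grid N (i + r) (j + l))}),
    (if b then F r l + G r l else 0) = (if b then F r l else 0) + (if b then G r l else 0)).
  { intros r l []; ring. }
  rewrite !K. ring.
Qed.

Lemma sumS_scal (k : R) (F : Z -> Z -> R) :
  sumS Om N i j (fun r l => k * F r l) = k * sumS Om N i j F.
Proof.
  unfold sumS, sum3.
  assert (K : forall r l (b : {closure Om (grid N (i + r) (j + l))}
                              + {~ closure Om (grid N (i + r) (j + l))}),
    (if b then k * F r l else 0) = k * (if b then F r l else 0)).
  { intros r l []; ring. }
  rewrite !K. ring.
Qed.

Lemma sumS_bound (F : Z -> Z -> R) (M : R) : 0 <= M ->
  (forall r l, (-1 <= r <= 1)%Z -> (-1 <= l <= 1)%Z ->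
     closure Om (grid N (i + r) (j + l)) -> Rabs (F r l) <= M) ->
  Rabs (sumS Om N i j F) <= 9 * M.
Proof.
  intros HM H.
  assert (K3 : forall G M', (forall r, (-1 <= r <= 1)%Z -> Rabs (G r) <= M') ->
    Rabs (sum3 G) <= 3 * M').
  { intros G M' HG. unfold sum3.
    generalize (HG (-1)%Z ltac:(lia)) (HG 0%Z ltac:(lia)) (HG 1%Z ltac:(lia)). intros.
    eapply Rle_trans; [apply Rabs_triang|].
    apply Rle_trans with (Rabs (G (-1)%Z) + Rabs (G 0%Z) + Rabs (G 1%Z)); [|lra].
    apply Rplus_le_compat_r, Rabs_triang. }
  replace (9 * M) with (3 * (3 * M)) by ring.
  apply K3; intros r Hr. apply K3; intros l Hl.
  destruct excluded_middle_informative; [now apply H | now rewrite Rabs_R0].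
Qed.
End Stencil.

(** * Distance of an irregular center to the boundary *)

(** Take the last parameter at which the segment is in the closure: points just
    after it are outside the closure, hence outside the domain. *)
Lemma segment_meets_boundary (Om : R * R -> Prop) P Q :
  closure Om P -> ~ closure Om Q ->
  exists s, 0 <= s <= 1 /\ boundary Om (along P Q s).
Proof.
  intros HP HQ.
  set (E := fun s => 0 <= s <= 1 /\ closure Om (along P Q s)).
  destruct (completeness E) as [m [Hub Hlub]].
  { exists 1. intros s Hs; apply Hs. }
  { exists 0. split; [lra | now rewrite along_0]. }
  assert (m0 : 0 <= m) by (apply Hub; split; [lra | now rewrite along_0]).
  assert (m1 : m <= 1) by (apply Hlub; intros s Hs; apply Hs).
  set (D := supd P Q + 1). assert (HD : 0 < D) by (unfold D; generalize (supd_pos P Q); lra).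
  assert (near : forall s (r : posreal), Rabs (s - m) < r / D ->
    supd (along P Q m) (along P Q s) < r).
  { intros s r Hs. rewrite supd_along. apply Rlt_div_r in Hs; [|exact HD].
    eapply Rle_lt_trans; [|exact Hs]. apply Rmult_le_compat_l; [apply Rabs_pos | unfold D; lra]. }
  assert (Cm : closure Om (along P Q m)).
  { intros r. set (r2 := pos_div_2 r).
    assert (Hr2 : 0 < r2 / D) by (apply Rdiv_lt_0_compat; [apply r2 | exact HD]).
    assert (HE : exists s, E s /\ m - r2 / D < s).
    { apply NNPP; intros HN. apply (Rlt_irrefl m).
      apply Rle_lt_trans with (m - r2 / D); [|lra].
      apply Hlub. intros s Hs. apply Rnot_lt_le; intros Hlt. apply HN; eauto. }
    destruct HE as [s [Es Hs]]. assert (s <= m) by now apply Hub.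
    destruct Es as [_ Cs]. destruct (Cs r2) as [X [OX BX]].
    exists X; split; [exact OX|]. apply supd_ball. apply supd_ball in BX.
    eapply Rle_lt_trans; [apply supd_triangle with (Q := along P Q s)|].
    assert (supd (along P Q m) (along P Q s) < r2) by (apply near, Rabs_def1; lra).
    unfold r2 in *; simpl in *; lra. }
  exists m; split; [lra|]. split; [exact Cm|].
  assert (m < 1).
  { destruct m1 as [|E1]; [assumption|]. exfalso; apply HQ. now rewrite <- (along_1 P Q), <- E1. }
  intros r. set (s := Rmin 1 (m + r / D / 2)).
  assert (Hr : 0 < r / D) by (apply Rdiv_lt_0_compat; [apply r | exact HD]).
  assert (Hs : m < s <= 1) by (split; [apply Rmin_glb_lt; lra | apply Rmin_l]).
  assert (Hs' : s <= m + r / D / 2) by apply Rmin_r.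
  exists (along P Q s). split; [|apply supd_ball, near, Rabs_def1; lra].
  intros HO. assert (s <= m); [|lra]. apply Hub. split; [lra | now apply domain_in_closure].
Qed.

Lemma dist_euc_supd P Q : supd P Q <= dist_euc (fst P) (snd P) (fst Q) (snd Q) <= 2 * supd P Q.
Proof.
  assert (G := supd_pos P Q).
  set (D := dist_euc _ _ _ _).
  assert (HD : 0 <= D) by apply sqrt_pos.
  assert (E : D * D = (fst Q - fst P) * (fst Q - fst P) + (snd Q - snd P) * (snd Q - snd P)).
  { unfold D, dist_euc. rewrite sqrt_sqrt; [unfold Rsqr; ring|].
    apply Rplus_le_le_0_compat; apply Rle_0_sqr. }
  assert (H1 := supd_fst P Q). assert (H2 := supd_snd P Q).
  apply Rabs_le_between in H1, H2. split; [apply supd_le; apply Rabs_le_between|].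
  all: revert E H1 H2; generalize (fst Q - fst P) (snd Q - snd P); intros x y E H1 H2.
  all: clearbody D; try split; nra.
Qed.

(** Some stencil leg leaves the closure, so it meets the boundary at a point within
    [h] of the center in both coordinates, thus within [2 h] in Euclidean distance. *)
Lemma irregular_center_near_boundary (Om : R * R -> Prop) N i j B : (1 <= N)%nat ->
  irregular_center Om N i j -> orth_projection Om (grid N i j) B ->
  supd (grid N i j) B <= 2 * step N.
Proof.
  intros HN [HC HI] [HB Hmin].
  assert (Hh : 0 < step N) by (apply Rinv_0_lt_compat, lt_0_INR; lia).
  assert (HX : exists r l, (-1 <= r <= 1)%Z /\ (-1 <= l <= 1)%Z /\
    ~ closure Om (grid N (i + r) (j + l))).
  { apply NNPP; intros H. apply HI. intros r l Hr Hl. apply NNPP; intros H'. apply H; eauto. }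
  destruct HX as [r [l [Hr [Hl HX]]]].
  destruct (segment_meets_boundary Om _ _ HC HX) as [s [Hs Bs]].
  set (P := grid N i j) in *. set (Q := grid N (i + r) (j + l)) in *.
  assert (Z1 : forall z, (-1 <= z <= 1)%Z -> Rabs (IZR z) <= 1).
  { intros z [z1 z2]. apply IZR_le in z1, z2. now apply Rabs_le_between. }
  assert (PQ : supd P Q <= step N).
  { apply supd_le; simpl; rewrite plus_IZR.
    - replace ((IZR i + IZR r) * step N - IZR i * step N) with (IZR r * step N) by ring.
      rewrite Rabs_mult, (Rabs_pos_eq (step N)) by lra. generalize (Z1 r Hr); nra.
    - replace ((IZR j + IZR l) * step N - IZR j * step N) with (IZR l * step N) by ring.
      rewrite Rabs_mult, (Rabs_pos_eq (step N)) by lra. generalize (Z1 l Hl); nra. }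
  assert (PX : supd P (along P Q s) <= step N).
  { rewrite <- (along_0 P Q) at 1. rewrite supd_along, Rminus_0_r, Rabs_pos_eq by lra.
    generalize (supd_pos P Q); nra. }
  generalize (Hmin _ Bs) (dist_euc_supd P B) (dist_euc_supd P (along P Q s)). lra.
Qed.

(** * The boundary condition, differentiated *)
Section BoundaryCondition.
Variables (Om : R * R -> Prop) (N : nat) (F : nat -> nat -> R * R -> R).
Variables (T : R -> Prop) (p q g : R -> R).
Hypothesis OmO : open Om.
Hypothesis Om_joined : forall B, boundary Om B -> locally_joined Om B.
Hypothesis N4 : (4 <= N)%nat.
Hypothesis jetF : jet Om N F.
Hypothesis T_open : open T.
Hypothesis on_boundary : forall t, T t -> boundary Om (p t, q t).
Hypothesis p_reg : Ck_param T 3 p.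
Hypothesis q_reg : Ck_param T 3 q.
Hypothesis bc : forall t, T t -> F 0%nat 0%nat (p t, q t) = g t.

Let X m n t := F m n (p t, q t).

Lemma param_derive f k t : Ck_param T 3 f -> (k < 3)%nat -> T t ->
  is_derive (Derive_n f k) t (Derive_n f (S k) t).
Proof.
  intros Hf Hk Ht. apply Derive_correct. now apply (Hf (S k) Hk).
Qed.

Lemma trace_derive m n t : (m + n <= 2)%nat -> T t ->
  is_derive (X m n) t (X (S m) n t * Derive_n p 1 t + X m (S n) t * Derive_n q 1 t).
Proof.
  intros Hmn Ht. apply (boundary_chain_rule Om N F T); auto; [lia | |].
  - apply (param_derive p 0); auto; lia.
  - apply (param_derive q 0); auto; lia.
Qed.

Lemma derive_from_identity (f G : R -> R) t l : T t ->
  (forall s, T s -> f s = G s) -> is_derive G t l -> Derive f t = l.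
Proof.
  intros Ht E H. apply is_derive_unique. eapply is_derive_ext_loc; [|exact H].
  eapply filter_imp; [|exact (T_open t Ht)]. intros s Hs; symmetry; now apply E.
Qed.

Lemma is_derive_Rmult (f1 f2 : R -> R) t l1 l2 : is_derive f1 t l1 -> is_derive f2 t l2 ->
  is_derive (fun s => f1 s * f2 s) t (l1 * f2 t + f1 t * l2).
Proof. intros H1 H2. apply (is_derive_mult f1 f2 t); auto. exact Rmult_comm. Qed.

Lemma is_derive_Rplus (f1 f2 : R -> R) t l1 l2 : is_derive f1 t l1 -> is_derive f2 t l2 ->
  is_derive (fun s => f1 s + f2 s) t (l1 + l2).
Proof. intros H1 H2. now apply (is_derive_plus f1 f2 t). Qed.

Let P k := Derive_n p k.
Let Q k := Derive_n q k.

Lemma boundary_derive1 t : T t ->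
  Derive_n g 1 t = X 1 0 t * P 1 t + X 0 1 t * Q 1 t.
Proof.
  intros Ht. apply (derive_from_identity g (X 0 0)); auto.
  - intros s Hs; symmetry; now apply bc.
  - apply trace_derive; auto.
Qed.

Ltac solve_derive :=
  cbv beta;
  lazymatch goal with
  | |- is_derive (fun s => @?a s + @?b s) _ _ => apply (is_derive_Rplus a b); solve_derive
  | |- is_derive (fun s => @?a s * @?b s) _ _ => apply (is_derive_Rmult a b); solve_derive
  | |- is_derive (fun s => X ?m ?n s) _ _ => apply (trace_derive m n); [lia | assumption]
  | |- is_derive (fun s => P ?k s) _ _ => apply (param_derive p k); [assumption | lia | assumption]
  | |- is_derive (fun s => Q ?k s) _ _ => apply (param_derive q k); [assumption | lia | assumption]
  end.

Lemma boundary_derive2 t : T t ->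
  Derive_n g 2 t =
  ((X 2 0 t * P 1 t + X 1 1 t * Q 1 t) * P 1 t + X 1 0 t * P 2 t)
  + ((X 1 1 t * P 1 t + X 0 2 t * Q 1 t) * Q 1 t + X 0 1 t * Q 2 t).
Proof.
  intros Ht. refine (derive_from_identity (Derive_n g 1) _ t _ Ht boundary_derive1 _).
  solve_derive.
Qed.

Lemma boundary_derive3 t : T t ->
  Derive_n g 3 t =
  ((((X 3 0 t * P 1 t + X 2 1 t * Q 1 t) * P 1 t + X 2 0 t * P 2 t)
    + ((X 2 1 t * P 1 t + X 1 2 t * Q 1 t) * Q 1 t + X 1 1 t * Q 2 t)) * P 1 t
   + (X 2 0 t * P 1 t + X 1 1 t * Q 1 t) * P 2 t
   + ((X 2 0 t * P 1 t + X 1 1 t * Q 1 t) * P 2 t + X 1 0 t * P 3 t))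
  + ((((X 2 1 t * P 1 t + X 1 2 t * Q 1 t) * P 1 t + X 1 1 t * P 2 t)
    + ((X 1 2 t * P 1 t + X 0 3 t * Q 1 t) * Q 1 t + X 0 2 t * Q 2 t)) * Q 1 t
   + (X 1 1 t * P 1 t + X 0 2 t * Q 1 t) * Q 2 t
   + ((X 1 1 t * P 1 t + X 0 2 t * Q 1 t) * Q 2 t + X 0 1 t * Q 3 t)).
Proof.
  intros Ht. refine (derive_from_identity (Derive_n g 2) _ t _ Ht boundary_derive2 _).
  solve_derive.
Qed.
End BoundaryCondition.

(** * Consistency of the scheme *)

(** With [|C| <= 4 M] the Taylor remainder contributes [4 * 3^4] to the constant; the
    products of [c sigma] with the Taylor term of degree [j], where [sigma + j >= 4],
    contribute [3 * 6^3 + 2 * 6^2 + 6]. *)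
Lemma truncation_bound (U : nat -> nat -> R) (c : nat -> R) (uX mu tau h K M : R) :
  0 <= K -> 0 <= M -> 0 <= h <= 1 -> Rabs mu <= 3 -> Rabs tau <= 3 ->
  (forall m n, (m + n <= 3)%nat -> Rabs (U m n) <= K) ->
  (forall sigma, (sigma <= 3)%nat -> Rabs (c sigma) <= M) ->
  Rabs (uX - taylor U 4 0 0 (h * mu) (h * tau)) <= K * (3 * h) ^ 4 ->
  let Tj j := taylor_term U j 0 0 mu tau in
  Rabs (sum_f_R0 (fun sigma => c sigma * h ^ sigma) 3 * uX
    - (c 0%nat * U 0%nat 0%nat
       + (c 0%nat * Tj 1%nat + c 1%nat * U 0%nat 0%nat) * h
       + (c 0%nat * Tj 2%nat + c 1%nat * Tj 1%nat + c 2%nat * U 0%nat 0%nat) * h ^ 2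
       + (c 0%nat * Tj 3%nat + c 1%nat * Tj 2%nat + c 2%nat * Tj 1%nat
          + c 3%nat * U 0%nat 0%nat) * h ^ 3))
  <= 1050 * (M * K) * h ^ 4.
Proof.
  intros HK HM Hh Hmu Htau HU Hc HX Tj.
  assert (HT : forall j, (j <= 3)%nat -> Rabs (Tj j) <= K * 6 ^ j).
  { intros j Hj. replace 6 with (2 * 3) by ring. apply taylor_term_bound; auto; [lra|].
    intros m n Hmn; apply HU; lia. }
  set (rho := uX - _) in HX.
  assert (EX : uX = U 0%nat 0%nat + h * Tj 1%nat + h ^ 2 * Tj 2%nat + h ^ 3 * Tj 3%nat + rho).
  { unfold rho, Tj. cbn [taylor]. rewrite !taylor_term_scal. cbn [taylor_term]. ring. }
  clearbody rho. rewrite EX. clear EX.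
  generalize (HT 1%nat ltac:(lia)) (HT 2%nat ltac:(lia)) (HT 3%nat ltac:(lia))
    (Hc 0%nat ltac:(lia)) (Hc 1%nat ltac:(lia)) (Hc 2%nat ltac:(lia)) (Hc 3%nat ltac:(lia)).
  cbn [sum_f_R0].
  generalize (Tj 1%nat) (Tj 2%nat) (Tj 3%nat) (c 0%nat) (c 1%nat) (c 2%nat) (c 3%nat).
  intros T1 T2 T3 c0 c1 c2 c3 H1 H2 H3 C0 C1 C2 C3.
  assert (Small : forall x A k, Rabs x <= A -> Rabs (x * h ^ k) <= A).
  { intros x A k Hx. rewrite Rabs_mult, <- (Rmult_1_r A).
    assert (Hk : 0 <= h ^ k) by (apply pow_le; lra).
    apply Rmult_le_compat; auto using Rabs_pos.
    rewrite Rabs_pos_eq, <- (pow1 k) by exact Hk. now apply pow_incr. }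
  assert (Prod : forall x y A B, Rabs x <= A -> Rabs y <= B -> Rabs (x * y) <= A * B).
  { intros x y A B Hx Hy. rewrite Rabs_mult. apply Rmult_le_compat; auto using Rabs_pos. }
  assert (Add : forall x y A B, Rabs x <= A -> Rabs y <= B -> Rabs (x + y) <= A + B).
  { intros x y A B Hx Hy. eapply Rle_trans; [apply Rabs_triang | lra]. }
  assert (Hh4 : Rabs (h ^ 4) <= h ^ 4) by (rewrite Rabs_pos_eq; [lra | apply pow_le; lra]).
  (* only the products of total order at least four in [h] survive *)
  match goal with |- Rabs ?x <= _ => replace x with
    ((c0 * h ^ 0 + c1 * h ^ 1 + c2 * h ^ 2 + c3 * h ^ 3) * rho
     + (c1 * T3 * h ^ 0 + c2 * T2 * h ^ 0 + c3 * T1 * h ^ 0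
        + c2 * T3 * h ^ 1 + c3 * T2 * h ^ 1 + c3 * T3 * h ^ 2) * h ^ 4)
    by ring end.
  eapply Rle_trans.
  - apply Add; [apply Prod; [|exact HX] | apply Prod; [|exact Hh4]];
      repeat apply Add; apply Small; try apply Prod; eassumption.
  - right; ring.
Qed.

Theorem theorem3p2
  (Om : R * R -> Prop) (T : R -> Prop)
  (alpha beta1 beta2 kappa phi u : R -> R -> R) (p q g : R -> R)
  (Om_domain : planar_domain Om) (Om_origin : Om (0, 0))
  (Om_smooth : Ck_boundary 3 Om)
  (alpha_reg : Ck_closure Om 2 alpha)
  (beta1_reg : Ck_closure Om 2 beta1) (beta2_reg : Ck_closure Om 2 beta2)
  (kappa_reg : Ck_closure Om 2 kappa) (phi_reg : Ck_closure Om 2 phi)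
  (u_reg : Ck_closure Om 4 u)
  (alpha_pos : forall x y : R, closure Om (x, y) -> 0 < alpha x y)
  (u_sol : elliptic_eq Om alpha beta1 beta2 kappa phi u)
  (T_open : open T)
  (p_reg : Ck_param T 3 p) (q_reg : Ck_param T 3 q) (g_reg : Ck_param T 3 g)
  (pq_boundary : forall P : R * R,
     boundary Om P <-> exists t : R, T t /\ P = (p t, q t))
  (u_bc : forall t : R, T t -> u (p t) (q t) = g t) :
  let J := bdata_at Om alpha beta1 beta2 kappa phi p q g in
  (forall (N : nat) (i j : Z) (t : R) (c : Z -> Z -> nat -> R),
     boundary_stencil Om T p q N i j t ->
     coeff_solution (J t) Om N i j (p t, q t) c ->
     scheme_rhs (J t) Om N i j (p t, q t) c 0 = g t)
  /\
  (* the O(h^4) constant is uniform over all coefficients bounded by M and all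
     boundary points in a fixed box, the whole boundary when it is bounded *)
  (forall M rho : R, exists K : R,
     eventually (fun N : nat =>
       forall (i j : Z) (t : R) (c : Z -> Z -> nat -> R),
         boundary_stencil Om T p q N i j t ->
         Rabs (p t) <= rho -> Rabs (q t) <= rho ->
         coeff_solution (J t) Om N i j (p t, q t) c ->
         coeff_bounded Om N i j M c ->
         Rabs (scheme_op Om N c
                 (fun i j => u (fst (grid N i j)) (snd (grid N i j))) i j
               - scheme_rhs (J t) Om N i j (p t, q t) c (step N))
         <= K * step N ^ 4)).
Proof.
  intros J.
  assert (OmO : open Om) by apply Om_domain.
  assert (Om_joined : forall B, boundary Om B -> locally_joined Om B)
    by (intros B; apply (boundary_joined Om 3); [lia | exact Om_smooth]).
  set (F := fun (m n : nat) (P : R * R) => pd Om m n u (fst P) (snd P)).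
  assert (jetF : jet Om 4 F) by now apply jet_pd.
  assert (F00_u : forall P, closure Om P -> F 0%nat 0%nat P = u (fst P) (snd P))
    by (intros [x y] HP; now apply u_reg).
  assert (on_bd : forall t, T t -> boundary Om (p t, q t))
    by (intros t Ht; apply pq_boundary; eauto).
  assert (bc : forall t, T t -> F 0%nat 0%nat (p t, q t) = g t).
  { intros t Ht. rewrite F00_u by now apply on_bd. now apply u_bc. }
  split.
  - intros N i j t c _ [_ [_ Hsum]]. unfold scheme_rhs.
    rewrite (sumS_ext Om N i j _ (fun r l => g t * c r l 0%nat)).
    + rewrite sumS_scal, Hsum. ring.
    + intros r l _ _ _. cbv zeta. simpl. ring.
  - intros M0 rho.
    set (M := Rmax M0 0).
    destruct (uniform_taylor Om 4 F OmO Om_joined ltac:(lia) jetF rho) as [e [K [K0 HK]]].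
    exists (9 * (1050 * (M * K))).
    assert (He3 : 0 < e / 3) by (generalize (cond_pos e); lra).
    destruct (nfloor_ex (3 / e)) as [N0 [_ HN0]].
    { apply Rlt_le, Rdiv_lt_0_compat; [lra | apply e]. }
    exists (S N0). intros N HN i j t c [N1 [Hirr [Ht [Hproj [P1 [_ [Q1 [Q2 [Q3 Q4]]]]]]]]] Bp Bq
      [Hrows _] Hc.
    set (h := step N).
    assert (INR_N : 1 <= INR N) by (apply (le_INR 1); lia).
    assert (Hh : 0 < h) by (apply Rinv_0_lt_compat; lra).
    assert (Hh1 : h <= 1) by (unfold h, step; rewrite <- Rinv_1; apply Rinv_le_contravar; lra).
    assert (Hhe : 3 * h < e).
    { assert (L : 3 / e < INR N).
      { eapply Rlt_le_trans; [exact HN0|]. apply le_INR in HN. rewrite S_INR in HN. lra. }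
      apply Rlt_div_l in L; [|apply e].
      unfold h, step. apply (Rmult_lt_reg_r (INR N)); [lra|].
      rewrite Rmult_assoc, Rinv_l by lra. lra. }
    set (B := (p t, q t)).
    assert (HB : boundary Om B) by now apply on_bd.
    assert (CB : closure Om B) by apply HB.
    assert (Near := irregular_center_near_boundary Om N i j B N1 Hirr Hproj).
    fold h in Near.
    set (U := fun m n => F m n B).
    assert (HU : forall m n, (m + n <= 3)%nat -> Rabs (U m n) <= K).
    { intros m n Hmn. generalize (HK B B 0%nat m n Bp Bq HB CB).
      replace (supd B B) with 0
        by (unfold supd; rewrite !Rminus_diag, Rabs_R0; symmetry; apply Rmax_left; lra).
      unfold remainder; cbn [taylor pow]. rewrite Rminus_0_r, Rmult_1_r.
      intros H; apply H; [apply e | lia]. }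
    (* the nondegeneracy of the tangent direction makes the denominators nonzero *)
    assert (D2_neq0 : @D2 (J t) <> 0).
    { change (Derive_n p 1 t ^ 2 - Derive_n q 1 t ^ 2 <> 0).
      replace (Derive_n p 1 t ^ 2 - Derive_n q 1 t ^ 2)
        with ((Derive_n p 1 t - Derive_n q 1 t) * (Derive_n p 1 t + Derive_n q 1 t)) by ring.
      apply Rmult_integral_contrapositive; split; intros E; [apply Q1 | apply Q2]; lra. }
    assert (D3_neq0 : @D3 (J t) <> 0).
    { change (Derive_n p 1 t ^ 2 - 3 * Derive_n q 1 t ^ 2 <> 0).
      assert (S3 : sqrt 3 * sqrt 3 = 3) by (apply sqrt_sqrt; lra).
      replace (Derive_n p 1 t ^ 2 - 3 * Derive_n q 1 t ^ 2)
        with ((-3) * ((Derive_n q 1 t - sqrt 3 / 3 * Derive_n p 1 t)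
                      * (Derive_n q 1 t + sqrt 3 / 3 * Derive_n p 1 t))).
      2: { transitivity (sqrt 3 * sqrt 3 / 3 * Derive_n p 1 t ^ 2 - 3 * Derive_n q 1 t ^ 2);
           [field | rewrite S3; field]. }
      apply Rmult_integral_contrapositive; split; [lra|].
      apply Rmult_integral_contrapositive; split; intros E; [apply Q3 | apply Q4]; lra. }
    destruct (reduced_equation_closure Om alpha beta1 beta2 kappa phi u OmO alpha_reg
      beta1_reg beta2_reg kappa_reg phi_reg u_reg alpha_pos u_sol (p t) (q t) CB)
      as [pde [pde_x pde_y]].
    rewrite (u_bc t Ht) in pde, pde_x, pde_y.
    assert (bc1 := boundary_derive1 Om 4 F T p q g OmO Om_joined ltac:(lia) jetF T_open on_bd
      p_reg q_reg bc t Ht).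
    assert (bc2 := boundary_derive2 Om 4 F T p q g OmO Om_joined ltac:(lia) jetF T_open on_bd
      p_reg q_reg bc t Ht).
    assert (bc3 := boundary_derive3 Om 4 F T p q g OmO Om_joined ltac:(lia) jetF T_open on_bd
      p_reg q_reg bc t Ht).
    set (row := fun k r l => @A_row (J t) (mu_at N i j B r) (tau_at N i j B l) (c r l) k).
    assert (Rows : forall k, (k < 6)%nat -> sumS Om N i j (row k) = 0) by exact Hrows.
    set (rhs := fun r l => @point_rhs (J t) (mu_at N i j B r) (tau_at N i j B l) (c r l) h).
    set (op := fun r l => sum_f_R0 (fun sigma => c r l sigma * h ^ sigma) 3
                          * u (fst (grid N (i + r) (j + l))) (snd (grid N (i + r) (j + l)))).
    set (free := fun r l => U 0%nat 1%nat * h * row 0%nat r l + (U 1%nat 1%nat * h ^ 2 * row 1%nat r l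
      + (U 0%nat 1%nat * h ^ 2 * row 3%nat r l + (U 2%nat 1%nat * h ^ 3 * row 2%nat r l
      + (U 1%nat 1%nat * h ^ 3 * row 4%nat r l + U 0%nat 1%nat * h ^ 3 * row 5%nat r l))))).
    change (Rabs (sumS Om N i j op - sumS Om N i j rhs) <= 9 * (1050 * (M * K)) * h ^ 4).
    (* the free derivatives drop out: the rows of the system sum to zero *)
    assert (Free : sumS Om N i j free = 0).
    { unfold free. rewrite !sumS_plus, !sumS_scal, !Rows by lia. ring. }
    replace (sumS Om N i j op - sumS Om N i j rhs)
      with (sumS Om N i j (fun r l => op r l + (-1) * (rhs r l + free r l)))
      by (rewrite sumS_plus, sumS_scal, sumS_plus, Free; ring).
    replace (9 * (1050 * (M * K)) * h ^ 4) with (9 * (1050 * (M * K) * h ^ 4)) by ring.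
    assert (HM : 0 <= M) by apply Rmax_r.
    apply sumS_bound.
    { apply Rmult_le_pos; [|apply pow_le; lra]. apply Rmult_le_pos; [lra | now apply Rmult_le_pos]. }
    intros r l Hr Hl HX.
    set (mu := mu_at N i j B r). set (tau := tau_at N i j B l).
    set (X := grid N (i + r) (j + l)) in *.
    assert (Z1 : forall z, (-1 <= z <= 1)%Z -> Rabs (IZR z) <= 1).
    { intros z [z1 z2]. apply IZR_le in z1, z2. now apply Rabs_le_between. }
    (* one from the offset in the stencil, two from the distance to the projection *)
    assert (Off : forall z a, (-1 <= z <= 1)%Z -> Rabs a <= 2 * h -> Rabs (IZR z + a / h) <= 3).
    { intros z a Hz Ha. eapply Rle_trans; [apply Rabs_triang|].
      assert (Rabs (a / h) <= 2); [|generalize (Z1 z Hz); lra].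
      unfold Rdiv. rewrite Rabs_mult, Rabs_inv, (Rabs_pos_eq h) by lra.
      apply (Rmult_le_reg_r h); [exact Hh|]. rewrite Rmult_assoc, Rinv_l; lra. }
    rewrite supd_sym in Near.
    assert (Hmu : Rabs mu <= 3)
      by (apply Off; [exact Hr | eapply Rle_trans; [apply supd_fst | exact Near]]).
    assert (Htau : Rabs tau <= 3)
      by (apply Off; [exact Hl | eapply Rle_trans; [apply supd_snd | exact Near]]).
    assert (Xmu : fst X - fst B = h * mu).
    { unfold X, mu, mu_at; simpl. fold h. rewrite plus_IZR. field; lra. }
    assert (Xtau : snd X - snd B = h * tau).
    { unfold X, tau, tau_at; simpl. fold h. rewrite plus_IZR. field; lra. }
    assert (BX : supd B X <= 3 * h).
    { apply supd_le; rewrite ?Xmu, ?Xtau, Rabs_mult, (Rabs_pos_eq h), Rmult_comm by lra;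
        apply Rmult_le_compat_r; lra. }
    assert (HT : Rabs (u (fst X) (snd X) - taylor U 4 0 0 (h * mu) (h * tau)) <= K * (3 * h) ^ 4).
    { rewrite <- Xmu, <- Xtau, <- (F00_u X HX).
      eapply Rle_trans; [apply (HK B X 4%nat 0%nat 0%nat); auto; lra|].
      apply Rmult_le_compat_l; [exact K0|]. apply pow_incr. split; [apply supd_pos | exact BX]. }
    assert (HcM : forall sigma, (sigma <= 3)%nat -> Rabs (c r l sigma) <= M)
      by (intros sigma Hs; eapply Rle_trans; [now apply Hc | apply Rmax_l]).
    assert (TB := truncation_bound U (c r l) _ mu tau h K M K0 HM ltac:(lra) Hmu Htau HU HcM HT).
    cbv zeta in TB.
    assert (EX := @expansion (J t) (U 1%nat 0%nat) (U 0%nat 1%nat) (U 2%nat 0%nat) (U 1%nat 1%nat)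
      (U 0%nat 2%nat) (U 3%nat 0%nat) (U 2%nat 1%nat) (U 1%nat 2%nat) (U 0%nat 3%nat)
      P1 D2_neq0 D3_neq0 bc1 bc2 bc3 pde pde_x pde_y mu tau (c r l) h).
    change (@point_rhs (J t) mu tau (c r l) h) with (rhs r l) in EX.
    replace (op r l + -1 * (rhs r l + free r l)) with (op r l - (rhs r l + free r l)) by ring.
    replace (rhs r l + free r l) with
      (c r l 0%nat * U 0%nat 0%nat
       + (c r l 0%nat * taylor_term U 1 0 0 mu tau + c r l 1%nat * U 0%nat 0%nat) * h
       + (c r l 0%nat * taylor_term U 2 0 0 mu tau + c r l 1%nat * taylor_term U 1 0 0 mu tau
          + c r l 2%nat * U 0%nat 0%nat) * h ^ 2
       + (c r l 0%nat * taylor_term U 3 0 0 mu tau + c r l 1%nat * taylor_term U 2 0 0 mu tau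
          + c r l 2%nat * taylor_term U 1 0 0 mu tau + c r l 3%nat * U 0%nat 0%nat) * h ^ 3);
      [exact TB|].
    etransitivity; [|exact EX].
    change (@g0 (J t)) with (g t).
    replace (U 0%nat 0%nat) with (g t) by (symmetry; now apply bc).
    clearbody U. cbn [taylor_term INR]. field.
Qed.
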